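(* Through Noether's theorem for the polar equations of motion $\frac{d^2r}{dt^2}=\omega^2r-U'(r)$, $\frac{d^2\theta}{dt^2}=-2\omega v/r$ (with $v=dr/dt$, $\omega=d\theta/dt$), the first integrals for angular momentum $L=\omega r^2$ and energy $E=\tfrac12v^2+\tfrac12L^2r^{-2}+U(r)-U(r_{\rm eq})$ correspond to the infinitesimal point symmetries $$\mathbf X_{(L)}=-\partial_\theta,\qquad \mathbf X_{(E)}=\partial_t,$$ while the first integrals given by the angular quantity $\Theta$ and the temporal quantity $T$, $$\Theta=\theta-L\int_{r_0}^{r}\frac{\operatorname{sgn}(v)\,ds}{\sqrt{2(E+U(r_{\rm eq})-U(s))s^4-L^2s^2}},\qquad T=t-\int_{r_0}^{r}\frac{\operatorname{sgn}(v)\,ds}{\sqrt{2(E+U(r_{\rm eq})-U(s))-L^2s^{-2}}},$$ correspond respectively to the infinitesimal dynamical symmetries $$\mathbf X_{(\Theta)}=\Theta_E\,\partial_t-\Theta_L\,\partial_\theta,\qquad \mathbf X_{(T)}=T_E\,\partial_t-T_L\,\partial_\theta .$$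
   Context: The mass is $m=1$; $U$ is a smooth radial potential on $r>0$; $U(r_{\rm eq})$ is a constant ($r_{\rm eq}$ a fixed equilibrium point, i.e. root of $U'$). $r_0=r_0(L,E)$ is a differentiable choice of turning point ($\tfrac12L^2r_0^{-2}+U(r_0)-U(r_{\rm eq})=E$) or inertial point ($r_0^3U'(r_0)=L^2$) on the trajectory. One works where $v\neq0$. $\Theta_L,\Theta_E,T_L,T_E$ denote partial derivatives of $\Theta$ and $T$ regarded as functions of the independent variables $(t,r,\theta,L,E)$ (with fixed $\operatorname{sgn}(v)$), after which $L,E$ are replaced by their expressions in $(r,v,\omega)$. The Lagrangian is $\mathcal L=\tfrac12(v^2+r^2\omega^2)-U(r)$, with variational derivatives $\frac{\delta\mathcal L}{\delta r}=\omega^2r-U'(r)-\frac{d^2r}{dt^2}$, $\frac{\delta\mathcal L}{\delta\theta}=-2\omega vr-r^2\frac{d^2\theta}{dt^2}$. An infinitesimal transformation $\mathbf X=\tau\partial_t+\xi\partial_r+\psi\partial_\theta$, whose components are functions of $(t,r,\theta,v,\omega)$, has characteristic form $\hat{\mathbf X}=P^r\partial_r+P^\theta\partial_\theta$, $P^r=\xi-v\tau$, $P^\theta=\psi-\omega\tau$; generators with the same characteristic form are equivalent. It is a point symmetry if $\tau,\xi,\psi$ depend only on $(t,r,\theta)$, and dynamical if they may depend on $v,\omega$. A first integral $I(t,r,\theta,v,\omega)$ (a function with $dI/dt=0$ on all solutions) corresponds through Noether's theorem to the symmetry $\mathbf X$ (up to equivalence) for which, identically for all functions $r(t),\theta(t)$,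 $$P^r\frac{\delta\mathcal L}{\delta r}+P^\theta\frac{\delta\mathcal L}{\delta\theta}=\frac{dI}{dt},$$ equivalently $P^r=-I_v$, $P^\theta=-r^{-2}I_\omega$. *)

(* Defs.v *)
(* Stdlib reals with Coquelicot. *)
From Stdlib Require Export Reals.
From Stdlib Require Import Lra.
From Coquelicot Require Export Coquelicot.
Open Scope R_scope.

(* Functions of (t, r, theta, v, omega), with v and omega independent
   coordinates standing for dr/dt and dtheta/dt. *)
Definition jet_function := R -> R -> R -> R -> R -> R.
Definition jet_domain := R -> R -> R -> R -> R -> Prop.

(* The generator tau d/dt + xi d/dr + psi d/dtheta.  With no further condition
   its components may depend on v and omega: it is a dynamical one. *)
Record generator := Generator {
  tau : jet_function;
  xi  : jet_function;
  psi : jet_function }.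

Definition is_point (X : generator) : Prop :=
  forall t r th v w v' w',
    tau X t r th v w = tau X t r th v' w' /\
    xi  X t r th v w = xi  X t r th v' w' /\
    psi X t r th v w = psi X t r th v' w'.

Definition char_r (X : generator) : jet_function :=
  fun t r th v w => xi X t r th v w - v * tau X t r th v w.

Definition char_th (X : generator) : jet_function :=
  fun t r th v w => psi X t r th v w - w * tau X t r th v w.

Definition equivalent_on (D : jet_domain) (X Y : generator) : Prop :=
  forall t r th v w, D t r th v w ->
    char_r X t r th v w = char_r Y t r th v w /\
    char_th X t r th v w = char_th Y t r th v w.

Definition along (I : jet_function) (r th : R -> R) (t : R) : R :=
  I t (r t) (th t) (Derive r t) (Derive th t).

Definition jet_in (D : jet_domain) (r th : R -> R) (t : R) : Prop :=
  D t (r t) (th t) (Derive r t) (Derive th t).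

Definition twice_differentiable_near (f : R -> R) (t : R) : Prop :=
  locally t (fun s => ex_derive f s /\ ex_derive (Derive f) s).

Definition is_curve (r th : R -> R) (t : R) : Prop :=
  twice_differentiable_near r t /\ twice_differentiable_near th t.

Definition is_solution (U : R -> R) (r th : R -> R) (t : R) : Prop :=
  is_curve r th t /\
  locally t (fun s =>
    0 < r s /\
    Derive (Derive r) s = (Derive th s) ^ 2 * r s - Derive U (r s) /\
    Derive (Derive th) s = - 2 * Derive th s * Derive r s / r s).

Definition lagrangian (U : R -> R) : jet_function :=
  fun _ r _ v w => / 2 * (v ^ 2 + r ^ 2 * w ^ 2) - U r.

Definition var_r (Lag : jet_function) (r th : R -> R) (t : R) : R :=
  Derive (fun x => Lag t x (th t) (Derive r t) (Derive th t)) (r t)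
  - Derive (fun s =>
      Derive (fun y => Lag s (r s) (th s) y (Derive th s)) (Derive r s)) t.

Definition var_th (Lag : jet_function) (r th : R -> R) (t : R) : R :=
  Derive (fun x => Lag t (r t) x (Derive r t) (Derive th t)) (th t)
  - Derive (fun s =>
      Derive (fun y => Lag s (r s) (th s) (Derive r s) y) (Derive th s)) t.

Lemma var_r_lagrangian U r th t :
  ex_derive U (r t) ->
  var_r (lagrangian U) r th t
  = (Derive th t) ^ 2 * r t - Derive U (r t) - Derive (Derive r) t.
Proof.
  intros HU; unfold var_r, lagrangian.
  replace (Derive (fun x => _) (r t))
    with ((Derive th t) ^ 2 * r t - Derive U (r t)).
  2:{ symmetry; apply is_derive_unique.
      auto_derive; [ exact HU | change (fun x : R => U x) with U; field ]. }
  f_equal; apply Derive_ext; intros s.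
  apply is_derive_unique; auto_derive; [ exact I | field ].
Qed.

Lemma var_th_lagrangian U r th t :
  ex_derive r t -> ex_derive (Derive th) t ->
  var_th (lagrangian U) r th t
  = - 2 * Derive th t * Derive r t * r t - (r t) ^ 2 * Derive (Derive th) t.
Proof.
  intros Hr Hth; unfold var_th, lagrangian.
  rewrite Derive_const.
  rewrite (Derive_ext _ (fun s => (r s) ^ 2 * Derive th s)).
  - replace (Derive (fun s => _) t)
      with (2 * r t * Derive r t * Derive th t + (r t) ^ 2 * Derive (Derive th) t);
      [ ring | ].
    symmetry; apply is_derive_unique.
    evar_last.
    + apply (is_derive_mult (fun s => (r s) ^ 2) (Derive th) t
               (2 * r t * Derive r t) (Derive (Derive th) t)).
      * auto_derive; [ exact Hr | change (fun x : R => r x) with r; ring ].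
      * now apply Derive_correct.
      * intros; apply Rmult_comm.
    + unfold plus, mult; simpl; ring.
  - intros s; apply is_derive_unique; auto_derive; [ exact I | field ].
Qed.

Definition first_integral (U : R -> R) (D : jet_domain) (I : jet_function) : Prop :=
  forall r th t, is_solution U r th t -> jet_in D r th t ->
    is_derive (along I r th) t 0.

Definition noether_identity
    (U : R -> R) (D : jet_domain) (I : jet_function) (X : generator) : Prop :=
  forall r th t, is_curve r th t -> jet_in D r th t ->
    is_derive (along I r th) t
      (along (char_r X) r th t * var_r (lagrangian U) r th t
       + along (char_th X) r th t * var_th (lagrangian U) r th t).

(* The last clause makes X "the" symmetry attached to I, up to equivalence. *)
Definition noether_corresponds
    (U : R -> R) (D : jet_domain) (I : jet_function) (X : generator) : Prop :=
  first_integral U D I /\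
  noether_identity U D I X /\
  (forall Y, noether_identity U D I Y -> equivalent_on D Y X).

Definition positive_radius : jet_domain := fun _ r _ _ _ => 0 < r.

Definition ang_mom : jet_function := fun _ r _ _ w => w * r ^ 2.

Definition energy (U : R -> R) (req : R) : jet_function :=
  fun t r th v w =>
    / 2 * v ^ 2 + / 2 * (ang_mom t r th v w) ^ 2 / r ^ 2 + U r - U req.

Definition X_L : generator :=
  Generator (fun _ _ _ _ _ => 0) (fun _ _ _ _ _ => 0) (fun _ _ _ _ _ => - 1).

Definition X_E : generator :=
  Generator (fun _ _ _ _ _ => 1) (fun _ _ _ _ _ => 0) (fun _ _ _ _ _ => 0).

Definition turning_point (U : R -> R) (req L E x : R) : Prop :=
  / 2 * L ^ 2 / x ^ 2 + U x - U req = E.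

Definition inertial_point (U : R -> R) (L x : R) : Prop :=
  x ^ 3 * Derive U x = L ^ 2.

Definition smooth_on_positive (U : R -> R) : Prop :=
  forall (n : nat) (x : R), 0 < x -> ex_derive_n U n x.

(* W is the set of (L, E) on which r0 is defined.  Both kinds of choice are
   uniform over W. *)
Definition differentiable_choice
    (U : R -> R) (req : R) (W : R -> R -> Prop) (r0 : R -> R -> R) : Prop :=
  (forall L E, W L E ->
     locally_2d W L E /\ 0 < r0 L E /\ differentiable_pt r0 L E) /\
  ((forall L E, W L E -> turning_point U req L E (r0 L E)) \/
   (forall L E, W L E -> inertial_point U L (r0 L E))).

(* The value of (dr/dt)^2 at radius s on a motion with invariants (L, E). *)
Definition radial_speed2 (U : R -> R) (req L E s : R) : R :=
  2 * (E + U req - U s) - L ^ 2 / s ^ 2.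

(* The radial motion with invariants (L, E) joins r to x: it does not stop
   strictly between them, and x is not an equilibrium of the radial motion
   (both a turning and an inertial point), which could only be approached
   asymptotically. *)
Definition on_trajectory (U : R -> R) (req L E r x : R) : Prop :=
  (forall s, Rmin x r < s < Rmax x r -> 0 < radial_speed2 U req L E s) /\
  ~ (turning_point U req L E x /\ inertial_point U L x).

Definition trajectory_domain
    (U : R -> R) (req : R) (W : R -> R -> Prop) (r0 : R -> R -> R) : jet_domain :=
  fun t r th v w =>
    let L := ang_mom t r th v w in
    let E := energy U req t r th v w in
    0 < r /\ v <> 0 /\ W L E /\ on_trajectory U req L E r (r0 L E).

(* At a turning point r0 the integrands below blow up, so the integrals are
   improper at their lower endpoint, approached from the side of the upper one. *)
Definition from_endpoint (a b : R) : (R -> Prop) -> Prop :=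
  match total_order_T a b with
  | inleft (left _) => at_right a
  | inleft (right _) => at_point a
  | inright _ => at_left a
  end.

Definition integral_converges (f : R -> R) (a b : R) : Prop :=
  ex_RInt_gen f (from_endpoint a b) (at_point b).

Definition integral (f : R -> R) (a b : R) : R :=
  RInt_gen f (from_endpoint a b) (at_point b).

(* sg is the sign of v, held fixed when differentiating in L and E. *)
Definition Theta_integrand (U : R -> R) (req sg L E : R) : R -> R :=
  fun s => sg / sqrt (2 * (E + U req - U s) * s ^ 4 - L ^ 2 * s ^ 2).

Definition T_integrand (U : R -> R) (req sg L E : R) : R -> R :=
  fun s => sg / sqrt (2 * (E + U req - U s) - L ^ 2 / s ^ 2).

Definition Theta (U : R -> R) (req : R) (r0 : R -> R -> R) (sg t r th L E : R) : R :=
  th - L * integral (Theta_integrand U req sg L E) (r0 L E) r.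

Definition T (U : R -> R) (req : R) (r0 : R -> R -> R) (sg t r th L E : R) : R :=
  t - integral (T_integrand U req sg L E) (r0 L E) r.

(* For F (sg, t, r, theta, L, E): F itself, dF/dL and dF/dE as functions of
   (t, r, theta, v, omega), after substituting for sg, L and E. *)
Definition on_jets (U : R -> R) (req : R)
    (F : R -> R -> R -> R -> R -> R -> R) : jet_function :=
  fun t r th v w =>
    F (sign v) t r th (ang_mom t r th v w) (energy U req t r th v w).

Definition dL (F : R -> R -> R -> R -> R -> R -> R) (sg t r th L E : R) : R :=
  Derive (fun l => F sg t r th l E) L.

Definition dE (F : R -> R -> R -> R -> R -> R -> R) (sg t r th L E : R) : R :=
  Derive (fun e => F sg t r th L e) E.

Definition X_dynamical (U : R -> R) (req : R)
    (F : R -> R -> R -> R -> R -> R -> R) : generator :=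
  Generator (on_jets U req (dE F))
            (fun _ _ _ _ _ => 0)
            (fun t r th v w => - on_jets U req (dL F) t r th v w).

(* Main.v *)
Require Import Defs.
From Stdlib Require Import Classical ClassicalEpsilon Lra.
Open Scope R_scope.

(** Along any curve, [dL/dt] and [dE/dt] are the combinations of the variational
    derivatives predicted by [-d_theta] and [d_t].  For [F = Theta] or [T], the
    terms of [dF/dt] coming from the explicit dependence on [(t, r, theta)]
    cancel, because the integrand at the endpoint [r] is the inverse radial speed
    up to a factor; hence [dF/dt = F_L dL/dt + F_E dE/dt], which is the Noether
    identity.

    The analytic content is the differentiability of the integrals in [(L, E)].
    At an inertial point [r0] they are proper integrals with a moving endpoint.
    A turning point [r0] is a simple zero of the squared radial speed [g], and two
    integrations by parts turn [w / sqrt g] into a boundary term vanishing at [r0]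
    and an integrand proportional to the power [3/2] of [g].  The positive part of
    [g] to the power [3/2] is of class C1, so that the lower endpoint can be
    replaced by a fixed one beyond [r0]. *)

(** * Functions of class C1 in two parameters *)

(** Differentiating [w / sqrt g] in [(L, E)] under the integral sign produces the power [-3/2] of
    [g], which is not integrable at a simple zero, and the boundary term at the moving [r0] is
    infinite as well; the two divergences only make sense together. One integration by parts would
    leave an integrand in [sqrt g], whose extension by zero still has an unbounded derivative; this
    is why a second one is made. Both divide by [g'], which is nonzero at a turning point because
    equilibria of the radial motion are excluded.

    The Noether identity is tested on arbitrary curves, along which [r], [L] and [E] vary
    simultaneously. The chain rule then asks for total differentiability in [(L, E)], not just for
    partial derivatives, and for a separation of the motion of [r] from that of [(L, E)]: the
    integral up to a nearby radius is the one up to the current radius plus a proper integral over a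
    short segment. Since [r0] is only differentiable, class C1 is asked of the integrands and never
    of the integrals. *)

Lemma locally_ball3 (P : R * (R * R) -> Prop) (s x y : R) :
  locally (s, (x, y)) P <->
  exists d : posreal, forall s' x' y',
    Rabs (s' - s) < d -> Rabs (x' - x) < d -> Rabs (y' - y) < d -> P (s', (x', y')).
Proof.
  split.
  - intros [d H]; exists d; intros s' x' y' H1 H2 H3; apply H.
    split; [ exact H1 | split; [ exact H2 | exact H3 ] ].
  - intros [d H]; exists d; intros [s' [x' y']] [H1 [H2 H3]]; simpl in *.
    apply H; assumption.
Qed.

(** Compactness of the segment, as in the tube lemma. The gauge has to be defined for every real
    [s], hence the dummy radius 1 off the segment. *)
Lemma locally_forall_segment (V : UniformSpace) (P : R * V -> Prop) (a b : R) (p : V) :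
  (forall s, Rmin a b <= s <= Rmax a b -> locally (s, p) P) ->
  locally p (fun p' => forall s, Rmin a b <= s <= Rmax a b -> P (s, p')).
Proof.
  intros H.
  assert (H' : forall s, exists d : posreal, Rmin a b <= s <= Rmax a b ->
            forall s' p', Rabs (s' - s) < d -> ball p d p' -> P (s', p')).
  { intros s; destruct (classic (Rmin a b <= s <= Rmax a b)) as [Hs|Hs].
    - destruct (H s Hs) as [d Hd]; exists d; intros _ s' p' H1 H2; apply Hd.
      split; [ exact H1 | exact H2 ].
    - exists (mkposreal 1 Rlt_0_1); tauto. }
  pose (delta s := proj1_sig (constructive_indefinite_description _ (H' s))).
  pose (Hdelta s := proj2_sig (constructive_indefinite_description _ (H' s))).
  destruct (compactness_value_1d (Rmin a b) (Rmax a b) delta) as [d Hd].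
  exists d; intros p' Hp' s Hs.
  destruct (NNPP _ (Hd s Hs)) as [c [Hc [Hsc Hdc]]].
  apply (Hdelta c Hc); [ exact Hsc | ].
  now apply ball_le with d.
Qed.

Definition dparam1 (f : R * (R * R) -> R) (q : R * (R * R)) : R :=
  Derive (fun x => f (fst q, (x, snd (snd q)))) (fst (snd q)).

Definition dparam2 (f : R * (R * R) -> R) (q : R * (R * R)) : R :=
  Derive (fun y => f (fst q, (fst (snd q), y))) (snd (snd q)).

(** Derivatives are taken in the parameters only; in the integration variable joint continuity is
    enough. A whole neighbourhood is required so that the mean value theorem applies between nearby
    parameters, and the witnesses [fx], [fy] are left free so that the closure rules need no
    computation with [Derive]. *)
Definition C1_params (f : R * (R * R) -> R) (q0 : R * (R * R)) : Prop :=
  exists fx fy : R * (R * R) -> R,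
    locally q0 (fun q =>
      continuous f q /\
      (is_derive (fun x => f (fst q, (x, snd (snd q)))) (fst (snd q)) (fx q) /\
       continuous fx q) /\
      (is_derive (fun y => f (fst q, (fst (snd q), y))) (snd (snd q)) (fy q) /\
       continuous fy q)).

Lemma C1_params_continuous f q0 :
  C1_params f q0 -> locally q0 (continuous f).
Proof.
  intros [fx [fy H]]; revert H; apply filter_imp; tauto.
Qed.

Lemma C1_params_ext f g q0 :
  locally q0 (fun q => f q = g q) -> C1_params f q0 -> C1_params g q0.
Proof.
  intros He [fx [fy H]]; exists fx, fy.
  apply locally_locally in He.
  generalize (filter_and _ _ He H); apply filter_imp.
  intros [s [x y]] [E [Hc [[Hx Hx'] [Hy Hy']]]]; simpl in *.
  apply locally_ball3 in E; destruct E as [d E].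
  assert (R0 : forall z : R, Rabs (z - z) < d)
    by (intros z; rewrite Rminus_diag, Rabs_R0; apply cond_pos).
  split; [ | split; split; try assumption ].
  - apply continuous_ext_loc with f; [ | exact Hc ].
    apply locally_ball3; exists d; intros; now apply E.
  - eapply is_derive_ext_loc; [ | exact Hx ].
    exists d; intros z Hz; apply E; [ apply R0 | exact Hz | apply R0 ].
  - eapply is_derive_ext_loc; [ | exact Hy ].
    exists d; intros z Hz; apply E; [ apply R0 | apply R0 | exact Hz ].
Qed.

Lemma C1_params_const_params (u : R -> R) (q0 : R * (R * R)) :
  locally (fst q0) (continuous u) -> C1_params (fun q => u (fst q)) q0.
Proof.
  intros Hu; exists (fun _ => 0), (fun _ => 0).
  assert (H : locally q0 (fun q => continuous u (fst q)))
    by (destruct q0 as [s p]; exact (continuous_fst s p _ Hu)).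
  revert H; apply filter_imp; intros [s p] Hq; simpl.
  split; [ | now split; split;
    (apply (is_derive_const (V := R_NormedModule)) || apply continuous_const) ].
  apply continuous_comp; [ apply continuous_fst | exact Hq ].
Qed.

Lemma C1_params_const (c : R) q0 : C1_params (fun _ => c) q0.
Proof.
  apply (C1_params_const_params (fun _ => c)).
  apply filter_forall; intros; apply continuous_const.
Qed.

Lemma C1_params_fst q0 : C1_params (fun q => fst (snd q)) q0.
Proof.
  exists (fun _ => 1), (fun _ => 0); apply filter_forall; intros [s [x y]]; simpl.
  split.
  - apply (continuous_comp snd fst); [ apply continuous_snd | apply continuous_fst ].
  - now split; split; (apply (is_derive_id (K := R_AbsRing))
      || apply (is_derive_const (V := R_NormedModule)) || apply continuous_const).
Qed.

Lemma C1_params_snd q0 : C1_params (fun q => snd (snd q)) q0.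
Proof.
  exists (fun _ => 0), (fun _ => 1); apply filter_forall; intros [s [x y]]; simpl.
  split.
  - apply (continuous_comp snd snd); apply continuous_snd.
  - now split; split; (apply (is_derive_id (K := R_AbsRing))
      || apply (is_derive_const (V := R_NormedModule)) || apply continuous_const).
Qed.

Lemma C1_params_plus f g q0 :
  C1_params f q0 -> C1_params g q0 -> C1_params (fun q => f q + g q) q0.
Proof.
  intros [fx [fy Hf]] [gx [gy Hg]].
  exists (fun q => fx q + gx q), (fun q => fy q + gy q).
  generalize (filter_and _ _ Hf Hg); apply filter_imp.
  intros q [[F [[Fx Fx'] [Fy Fy']]] [G [[Gx Gx'] [Gy Gy']]]].
  split; [ | split; split ].
  - now apply (continuous_plus f g).
  - exact (is_derive_plus _ _ _ _ _ Fx Gx).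
  - now apply (continuous_plus fx gx).
  - exact (is_derive_plus _ _ _ _ _ Fy Gy).
  - now apply (continuous_plus fy gy).
Qed.

Lemma C1_params_mult f g q0 :
  C1_params f q0 -> C1_params g q0 -> C1_params (fun q => f q * g q) q0.
Proof.
  intros [fx [fy Hf]] [gx [gy Hg]].
  exists (fun q => fx q * g q + f q * gx q), (fun q => fy q * g q + f q * gy q).
  generalize (filter_and _ _ Hf Hg); apply filter_imp.
  intros [s [x y]] [[F [[Fx Fx'] [Fy Fy']]] [G [[Gx Gx'] [Gy Gy']]]].
  split; [ | split; split ].
  - now apply (continuous_mult f g).
  - exact (is_derive_mult _ _ _ _ _ Fx Gx Rmult_comm).
  - now apply (continuous_plus (fun q => fx q * g q) (fun q => f q * gx q));
      [ apply (continuous_mult fx g) | apply (continuous_mult f gx) ].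
  - exact (is_derive_mult _ _ _ _ _ Fy Gy Rmult_comm).
  - now apply (continuous_plus (fun q => fy q * g q) (fun q => f q * gy q));
      [ apply (continuous_mult fy g) | apply (continuous_mult f gy) ].
Qed.

Lemma C1_params_comp (phi dphi : R -> R) f q0 :
  C1_params f q0 ->
  locally (f q0) (fun u => is_derive phi u (dphi u) /\ continuous dphi u) ->
  C1_params (fun q => phi (f q)) q0.
Proof.
  intros Hf Hphi.
  assert (Hc : continuous f q0) by (eapply locally_singleton, C1_params_continuous, Hf).
  apply Hc in Hphi; destruct Hf as [fx [fy Hf]].
  exists (fun q => fx q * dphi (f q)), (fun q => fy q * dphi (f q)).
  generalize (filter_and _ _ Hf Hphi); apply filter_imp.
  intros [s [x y]] [[F [[Fx Fx'] [Fy Fy']]] [D C]]; simpl in *.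
  assert (C' : continuous (fun q => dphi (f q)) (s, (x, y)))
    by now apply (continuous_comp f dphi).
  split; [ | split; split ].
  - apply (continuous_comp f phi); [ exact F | ].
    apply (ex_derive_continuous (V := R_NormedModule)); now exists (dphi (f (s, (x, y)))).
  - exact (is_derive_comp phi _ x _ _ D Fx).
  - now apply (continuous_mult fx (fun q => dphi (f q))).
  - exact (is_derive_comp phi _ y _ _ D Fy).
  - now apply (continuous_mult fy (fun q => dphi (f q))).
Qed.

Lemma C1_params_inv f q0 :
  C1_params f q0 -> f q0 <> 0 -> C1_params (fun q => / f q) q0.
Proof.
  intros Hf H0; apply (C1_params_comp Rinv (fun u => - / u ^ 2)); [ exact Hf | ].
  assert (H : locally (f q0) (fun u => u <> 0)) by (now apply open_neq).
  revert H; apply filter_imp; intros u Hu; split.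
  - auto_derive; [ exact Hu | now field ].
  - apply (ex_derive_continuous (V := R_NormedModule)); auto_derive.
    repeat split; auto; now apply (pow_nonzero u 2).
Qed.

Lemma C1_params_sqrt f q0 :
  C1_params f q0 -> 0 < f q0 -> C1_params (fun q => sqrt (f q)) q0.
Proof.
  intros Hf H0; apply (C1_params_comp sqrt (fun u => / (2 * sqrt u))); [ exact Hf | ].
  assert (H : locally (f q0) (fun u => 0 < u)) by (now apply open_gt).
  revert H; apply filter_imp; intros u Hu; split.
  - auto_derive; [ exact Hu | field ]; apply Rgt_not_eq, sqrt_lt_R0, Hu.
  - apply (ex_derive_continuous (V := R_NormedModule)); auto_derive; split; [ exact Hu | split; auto ].
    apply Rgt_not_eq; assert (0 < sqrt u) by (now apply sqrt_lt_R0); lra.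
Qed.

(* As [sqrt] vanishes on negative numbers, [u * sqrt u] is the power [3/2] of
   the positive part of [u], which is of class C1 on the whole line. *)
Lemma is_derive_mult_sqrt (u : R) :
  is_derive (fun x => x * sqrt x) u (3 / 2 * sqrt u).
Proof.
  destruct (total_order_T u 0) as [[Hu|Hu]|Hu].
  - rewrite (sqrt_neg_0 u) by lra.
    apply is_derive_ext_loc with (fun _ => 0).
    + generalize (open_lt 0 u Hu); apply filter_imp; intros x Hx.
      rewrite sqrt_neg_0 by lra; symmetry; apply Rmult_0_r.
    + rewrite Rmult_0_r; apply (is_derive_const (V := R_NormedModule)).
  - subst u; rewrite sqrt_0, Rmult_0_r.
    apply is_derive_Reals; intros eps He.
    (* The difference quotient at 0 is [sqrt h], which is below [eps] once [h < eps ^ 2]. *)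
    exists (mkposreal (eps ^ 2) (pow_lt _ 2 He)); intros h Hh Hlt; simpl in Hlt.
    rewrite Rplus_0_l, sqrt_0.
    replace ((h * sqrt h - 0 * 0) / h - 0) with (sqrt h) by (field; exact Hh).
    rewrite Rabs_pos_eq by apply sqrt_pos.
    destruct (Rle_dec h 0) as [H|H]; [ rewrite sqrt_neg_0; lra | ].
    rewrite <- (sqrt_pow2 eps) by lra.
    apply sqrt_lt_1_alt; rewrite Rabs_pos_eq in Hlt by lra; lra.
  - auto_derive; [ exact Hu | ].
    assert (Hs := sqrt_lt_R0 u Hu).
    replace (u * (1 * / (2 * sqrt u))) with (/ 2 * sqrt u); [ field | ].
    rewrite <- (sqrt_sqrt u) at 2 by lra; field; lra.
Qed.

Lemma C1_params_mult_sqrt f q0 :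
  C1_params f q0 -> C1_params (fun q => f q * sqrt (f q)) q0.
Proof.
  intros Hf.
  apply (C1_params_comp (fun u => u * sqrt u) (fun u => 3 / 2 * sqrt u));
    [ exact Hf | ].
  apply filter_forall; intros u; split; [ apply is_derive_mult_sqrt | ].
  apply (continuous_mult (fun _ => 3 / 2) sqrt);
    [ apply continuous_const | apply continuous_sqrt ].
Qed.

(** * Integrals depending on two parameters *)

Lemma continuous_section {V W : UniformSpace} (f : R * V -> W) (s : R) (p : V) :
  continuous f (s, p) -> continuous (fun x => f (x, p)) s.
Proof.
  intros H P HP; destruct (H P HP) as [d Hd]; exists d; intros x Hx.
  apply Hd; split; [ exact Hx | apply ball_center ].
Qed.

(** The witnesses may differ from one base point to the next, hence cannot be integrated in [s].
    They agree with [Derive] on a neighbourhood, so their continuity passes to [dparam1] and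
    [dparam2], which are defined globally. *)
Lemma C1_params_dparam f q0 :
  C1_params f q0 ->
  locally q0 (fun q =>
    continuous f q /\
    (is_derive (fun x => f (fst q, (x, snd (snd q)))) (fst (snd q)) (dparam1 f q) /\
     continuous (dparam1 f) q) /\
    (is_derive (fun y => f (fst q, (fst (snd q), y))) (snd (snd q)) (dparam2 f q) /\
     continuous (dparam2 f) q)).
Proof.
  intros [fx [fy H]].
  assert (E : locally q0 (fun q => dparam1 f q = fx q /\ dparam2 f q = fy q)).
  { revert H; apply filter_imp; intros q [_ [[Hx _] [Hy _]]]; split;
      now apply is_derive_unique. }
  apply locally_locally in E.
  generalize (filter_and _ _ E H); apply filter_imp.
  intros q [Eq [Hc [[Hx Hx'] [Hy Hy']]]].
  destruct (locally_singleton _ _ Eq) as [E1 E2].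
  split; [ exact Hc | split; split ].
  - now rewrite E1.
  - apply continuous_ext_loc with fx; [ | exact Hx' ].
    revert Eq; apply filter_imp; intros z [Hz _]; now rewrite Hz.
  - now rewrite E2.
  - apply continuous_ext_loc with fy; [ | exact Hy' ].
    revert Eq; apply filter_imp; intros z [_ Hz]; now rewrite Hz.
Qed.

(** The mean value theorem is applied along the path [(x0, y0)], [(x0, y)], [(x, y)] at fixed [s].
    The expansion is centred at [(s, p0)] with [s] free near [s0], so that [locally_forall_segment]
    can make it uniform over an interval of integration. *)
Lemma C1_params_taylor f (s0 x0 y0 : R) (eps : posreal) :
  C1_params f (s0, (x0, y0)) ->
  locally (s0, (x0, y0)) (fun q =>
    let p0 := (x0, y0) in
    Rabs (f q - f (fst q, p0)
          - (dparam1 f (fst q, p0) * (fst (snd q) - x0)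
             + dparam2 f (fst q, p0) * (snd (snd q) - y0)))
    <= eps * Rmax (Rabs (fst (snd q) - x0)) (Rabs (snd (snd q) - y0))).
Proof.
  intros H; apply C1_params_dparam in H.
  destruct (locally_singleton _ _ H) as [_ [[_ C1] [_ C2]]].
  (* The derivatives at the intermediate point and at [(s, p0)] are each within [eps / 4] of the
     value at [(s0, p0)]; each of the two increments thus costs [eps / 2]. *)
  assert (He : 0 < eps / 4) by (destruct eps; simpl; lra).
  specialize (C1 _ (locally_ball (dparam1 f (s0, (x0, y0))) (mkposreal _ He))).
  specialize (C2 _ (locally_ball (dparam2 f (s0, (x0, y0))) (mkposreal _ He))).
  unfold filtermap in C1, C2.
  assert (K := filter_and _ _ H (filter_and _ _ C1 C2)).
  clear H C1 C2; apply locally_ball3 in K; destruct K as [d K].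
  apply locally_ball3; exists d; intros s x y Hs Hx Hy; simpl.
  assert (R0 : forall z : R, Rabs (z - z) < d)
    by (intros z; rewrite Rminus_diag, Rabs_R0; apply cond_pos).
  assert (Hull : forall u u0 z : R, Rabs (u - u0) < d ->
            Rmin u0 u <= z <= Rmax u0 u -> Rabs (z - u0) < d).
  { intros u u0 z; unfold Rmin, Rmax, Rabs.
    destruct (Rle_dec u0 u), (Rcase_abs (u - u0)), (Rcase_abs (z - u0)); lra. }
  destruct (MVT_gen (fun z => f (s, (z, y))) x0 x (fun z => dparam1 f (s, (z, y))))
    as [xi [Hxi Ex]].
  { intros z Hz; apply (K s z y); try easy.
    apply (Hull x); [ easy | lra ]. }
  { intros z Hz; apply derivable_continuous_pt; exists (dparam1 f (s, (z, y))).
    apply is_derive_Reals, (K s z y); try easy. now apply (Hull x). }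
  destruct (MVT_gen (fun z => f (s, (x0, z))) y0 y (fun z => dparam2 f (s, (x0, z))))
    as [eta [Heta Ey]].
  { intros z Hz; apply (K s x0 z); try easy.
    apply (Hull y); [ easy | lra ]. }
  { intros z Hz; apply derivable_continuous_pt; exists (dparam2 f (s, (x0, z))).
    apply is_derive_Reals, (K s x0 z); try easy. now apply (Hull y). }
  apply Hull in Hxi; [ | easy ]; apply Hull in Heta; [ | easy ].
  destruct (K s xi y Hs Hxi Hy) as [_ [A1 _]].
  destruct (K s x0 eta Hs (R0 x0) Heta) as [_ [_ A2]].
  destruct (K s x0 y0 Hs (R0 x0) (R0 y0)) as [_ [B1 B2]].
  assert (D1 : Rabs (dparam1 f (s, (xi, y)) - dparam1 f (s, (x0, y0))) <= eps / 2).
  { unfold ball in A1, B1; simpl in A1, B1; unfold AbsRing_ball, abs, minus, plus, opp in A1, B1.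
    simpl in A1, B1. revert A1 B1; unfold Rabs; do 3 destruct Rcase_abs; lra. }
  assert (D2 : Rabs (dparam2 f (s, (x0, eta)) - dparam2 f (s, (x0, y0))) <= eps / 2).
  { unfold ball in A2, B2; simpl in A2, B2; unfold AbsRing_ball, abs, minus, plus, opp in A2, B2.
    simpl in A2, B2. revert A2 B2; unfold Rabs; do 3 destruct Rcase_abs; lra. }
  replace (f (s, (x, y)) - f (s, (x0, y0)) - _)
    with ((dparam1 f (s, (xi, y)) - dparam1 f (s, (x0, y0))) * (x - x0)
          + (dparam2 f (s, (x0, eta)) - dparam2 f (s, (x0, y0))) * (y - y0))
    by (simpl in Ex, Ey; nra).
  eapply Rle_trans; [ apply Rabs_triang | rewrite !Rabs_mult ].
  assert (M1 := Rmax_l (Rabs (x - x0)) (Rabs (y - y0))).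
  assert (M2 := Rmax_r (Rabs (x - x0)) (Rabs (y - y0))).
  assert (P1 := Rabs_pos (x - x0)); assert (P2 := Rabs_pos (y - y0)).
  assert (Q1 := Rabs_pos (dparam1 f (s, (xi, y)) - dparam1 f (s, (x0, y0)))).
  assert (Q2 := Rabs_pos (dparam2 f (s, (x0, eta)) - dparam2 f (s, (x0, y0)))).
  set (m := Rmax (Rabs (x - x0)) (Rabs (y - y0))) in *.
  assert (T1 := Rmult_le_compat _ _ _ _ Q1 P1 D1 M1).
  assert (T2 := Rmult_le_compat _ _ _ _ Q2 P2 D2 M2).
  lra.
Qed.

Lemma ex_RInt_section {V : UniformSpace} (f : R * V -> R) (a b : R) (p : V) :
  (forall s, Rmin a b <= s <= Rmax a b -> continuous f (s, p)) ->
  ex_RInt (fun s => f (s, p)) a b.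
Proof.
  intros H; apply (ex_RInt_continuous (V := R_CompleteNormedModule)); intros s Hs.
  apply (continuous_section f); auto.
Qed.

(** The uniform expansion of [C1_params_taylor] is integrated over the segment; the error is
    multiplied by its length at most. *)
Lemma differentiable_RInt_params f (a b x0 y0 : R) :
  (forall s, Rmin a b <= s <= Rmax a b -> C1_params f (s, (x0, y0))) ->
  differentiable_pt (fun x y => RInt (fun s => f (s, (x, y))) a b) x0 y0.
Proof.
  intros H.
  set (p0 := (x0, y0)).
  exists (RInt (fun s => dparam1 f (s, p0)) a b),
         (RInt (fun s => dparam2 f (s, p0)) a b).
  assert (C : forall s, Rmin a b <= s <= Rmax a b ->
    continuous f (s, p0) /\ continuous (dparam1 f) (s, p0) /\
    continuous (dparam2 f) (s, p0)).
  { intros s Hs; specialize (H s Hs); apply C1_params_dparam in H.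
    apply locally_singleton in H; tauto. }
  assert (I0 : ex_RInt (fun s => f (s, p0)) a b)
    by (apply (ex_RInt_section f); intros s Hs; apply (C s Hs)).
  assert (I1 : ex_RInt (fun s => dparam1 f (s, p0)) a b)
    by (apply (ex_RInt_section (dparam1 f)); intros s Hs; apply (C s Hs)).
  assert (I2 : ex_RInt (fun s => dparam2 f (s, p0)) a b)
    by (apply (ex_RInt_section (dparam2 f)); intros s Hs; apply (C s Hs)).
  intros eps; apply locally_2d_locally.
  (* Adding 1 keeps the denominator positive when [a = b]. *)
  assert (He : 0 < eps / (Rabs (b - a) + 1)).
  { apply Rdiv_lt_0_compat; [ apply cond_pos | ].
    generalize (Rabs_pos (b - a)); lra. }
  assert (L1 := locally_forall_segment _ _ a b p0
    (fun s Hs => C1_params_taylor f s x0 y0 (mkposreal _ He) (H s Hs))).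
  assert (L2 := locally_forall_segment _ _ a b p0
    (fun s Hs => C1_params_continuous _ _ (H s Hs))).
  generalize (filter_and _ _ L1 L2); apply filter_imp; clear L1 L2.
  intros [x y] [K1 K2]; simpl in *.
  assert (I : ex_RInt (fun s => f (s, (x, y))) a b) by now apply (ex_RInt_section f).
  set (m := Rmax (Rabs (x - x0)) (Rabs (y - y0))) in *.
  set (g s := f (s, (x, y)) - f (s, p0)
     - (dparam1 f (s, p0) * (x - x0) + dparam2 f (s, p0) * (y - y0))).
  assert (G : is_RInt g a b (RInt (fun s => f (s, (x, y))) a b
     - RInt (fun s => f (s, p0)) a b
     - (RInt (fun s => dparam1 f (s, p0)) a b * (x - x0)
        + RInt (fun s => dparam2 f (s, p0)) a b * (y - y0)))).
  { assert (J := is_RInt_minus _ _ _ _ _ _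
      (is_RInt_minus _ _ _ _ _ _ (RInt_correct _ _ _ I) (RInt_correct _ _ _ I0))
      (is_RInt_plus _ _ _ _ _ _
        (is_RInt_scal _ _ _ (x - x0) _ (RInt_correct _ _ _ I1))
        (is_RInt_scal _ _ _ (y - y0) _ (RInt_correct _ _ _ I2)))).
    rewrite (Rmult_comm _ (x - x0)), (Rmult_comm _ (y - y0)).
    eapply is_RInt_ext; [ | exact J ].
    intros s _; unfold g, minus, plus, opp, scal; simpl; unfold mult; simpl.
    ring. }
  assert (Hb := norm_RInt_le_const_abs g a b _ (eps / (Rabs (b - a) + 1) * m) K1 G).
  eapply Rle_trans; [ exact Hb | ].
  assert (Hm : 0 <= m)
    by (eapply Rle_trans; [ apply (Rabs_pos (x - x0)) | apply Rmax_l ]).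
  rewrite <- Rmult_assoc; apply Rmult_le_compat_r; [ exact Hm | ].
  assert (Hn := Rabs_pos (b - a)).
  apply (Rmult_le_reg_r (Rabs (b - a) + 1)); [ lra | ].
  field_simplify; [ | lra ].
  destruct eps as [e He']; simpl in *; nra.
Qed.

(** * Moving and singular endpoints *)

(** Near [(a, p0)] all values of [f] are within [eps] of [f (a, p0)], whatever the parameter; the
    estimate is therefore uniform in [snd q]. *)
Lemma RInt_short_segment {V : UniformSpace} (f : R * V -> R) (a : R) (p0 : V)
    (eps : posreal) :
  locally (a, p0) (continuous f) ->
  locally (a, p0) (fun q =>
    Rabs (RInt (fun s => f (s, snd q)) a (fst q) - f (a, p0) * (fst q - a))
    <= eps * Rabs (fst q - a)).
Proof.
  intros H.
  assert (K : locally (a, p0) (fun q => continuous f q /\ Rabs (f q - f (a, p0)) < eps)).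
  { apply filter_and; [ exact H | ].
    apply (locally_singleton _ _ H (fun u => Rabs (u - f (a, p0)) < eps)).
    exact (locally_ball (f (a, p0)) eps). }
  destruct K as [d K]; exists d; intros [b p] [Hb Hp]; simpl in *.
  assert (K' : forall s, Rmin a b <= s <= Rmax a b ->
            continuous f (s, p) /\ Rabs (f (s, p) - f (a, p0)) < eps).
  { intros s Hs; apply K; split; [ | exact Hp ]; simpl.
    change (Rabs (s - a) < d); change (Rabs (b - a) < d) in Hb.
    revert Hb Hs; unfold Rmin, Rmax, Rabs.
    destruct (Rle_dec a b), (Rcase_abs (b - a)), (Rcase_abs (s - a)); lra. }
  assert (I : ex_RInt (fun s => f (s, p)) a b)
    by (apply (ex_RInt_section f); intros s Hs; apply (K' s Hs)).
  assert (J := is_RInt_minus _ _ _ _ _ _ (RInt_correct _ _ _ I)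
                 (is_RInt_const a b (f (a, p0)))).
  assert (B := norm_RInt_le_const_abs (V := R_NormedModule)
    (fun s => f (s, p) - f (a, p0)) a b _ eps
    (fun s Hs => Rlt_le _ _ (proj2 (K' s Hs))) J).
  rewrite (Rmult_comm eps), (Rmult_comm (f (a, p0))); exact B.
Qed.

(** At [(x0, y0)] the interval of integration is a single point, so a change of the parameter [p]
    has no effect to first order and continuity is enough for it. This serves both for the lower
    endpoint [r0] and for the upper endpoint moving in time. *)
Lemma differentiable_RInt_endpoint {V : UniformSpace} (f : R * V -> R)
    (q : R -> R -> R) (p : R -> R -> V) (x0 y0 qx qy : R) :
  locally (q x0 y0, p x0 y0) (continuous f) ->
  differentiable_pt_lim q x0 y0 qx qy ->
  filterlim (fun z : R * R => p (fst z) (snd z)) (locally (x0, y0)) (locally (p x0 y0)) ->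
  differentiable_pt_lim
    (fun x y => RInt (fun s => f (s, p x y)) (q x0 y0) (q x y)) x0 y0
    (f (q x0 y0, p x0 y0) * qx) (f (q x0 y0, p x0 y0) * qy).
Proof.
  intros Hf Hq Hp eps.
  set (c := f (q x0 y0, p x0 y0)).
  assert (E1 : 0 < eps / (2 * (Rabs qx + Rabs qy + 1))).
  { apply Rdiv_lt_0_compat; [ apply cond_pos | ].
    generalize (Rabs_pos qx) (Rabs_pos qy); lra. }
  (* The bound 1 gives [Rabs dq <= (Rabs qx + Rabs qy + 1) * m], which the denominator in [E1]
     anticipates; the other bound makes the linearization error of [q], multiplied by [c], at most
     [eps / 2 * m]. *)
  assert (E2 : 0 < Rmin 1 (eps / (2 * (Rabs c + 1)))).
  { apply Rmin_pos; [ lra | ]; apply Rdiv_lt_0_compat; [ apply cond_pos | ].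
    generalize (Rabs_pos c); lra. }
  assert (K1 : locally (x0, y0) (fun z => let x := fst z in let y := snd z in
     Rabs (RInt (fun s => f (s, p x y)) (q x0 y0) (q x y) - c * (q x y - q x0 y0))
     <= eps / (2 * (Rabs qx + Rabs qy + 1)) * Rabs (q x y - q x0 y0))).
  { destruct (RInt_short_segment f _ _ (mkposreal _ E1) Hf) as [d Hd].
    assert (C : continuity_2d_pt q x0 y0)
      by (apply differentiable_continuity_pt; exists qx, qy; exact Hq).
    specialize (C d); apply locally_2d_locally in C.
    generalize (filter_and _ _ C (Hp _ (locally_ball _ d))); apply filter_imp.
    intros [x y] [C1 C2]; simpl in *.
    apply (Hd (q x y, p x y)); split; [ exact C1 | exact C2 ]. }
  specialize (Hq (mkposreal _ E2)); apply locally_2d_locally in Hq.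
  apply locally_2d_locally.
  generalize (filter_and _ _ K1 Hq); apply filter_imp; clear K1 Hq.
  intros [x y] [K1 K2]; simpl in *.
  rewrite RInt_point.
  assert (M1 := Rmax_l (Rabs (x - x0)) (Rabs (y - y0))).
  assert (M2 := Rmax_r (Rabs (x - x0)) (Rabs (y - y0))).
  assert (M3 := Rabs_pos (x - x0)).
  set (m := Rmax (Rabs (x - x0)) (Rabs (y - y0))) in *.
  set (dq := q x y - q x0 y0) in *.
  set (J := RInt _ _ _) in *.
  change zero with 0.
  set (l := qx * (x - x0) + qy * (y - y0)) in *.
  replace (J - 0 - _) with ((J - c * dq) + c * (dq - l)) by (unfold l; ring).
  eapply Rle_trans; [ apply Rabs_triang | ].
  assert (Hl : Rabs l <= (Rabs qx + Rabs qy) * m).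
  { unfold l; eapply Rle_trans; [ apply Rabs_triang | ].
    rewrite !Rabs_mult, Rmult_plus_distr_r.
    apply Rplus_le_compat; apply Rmult_le_compat_l; auto; apply Rabs_pos. }
  assert (Hdq : Rabs dq <= (Rabs qx + Rabs qy + 1) * m).
  { replace dq with (l + (dq - l)) by ring.
    eapply Rle_trans; [ apply Rabs_triang | ].
    assert (Rmin 1 (eps / (2 * (Rabs c + 1))) * m <= 1 * m)
      by (apply Rmult_le_compat_r; [ lra | apply Rmin_l ]).
    lra. }
  assert (T1 : eps / (2 * (Rabs qx + Rabs qy + 1)) * Rabs dq <= eps / 2 * m).
  { eapply Rle_trans; [ apply Rmult_le_compat_l; [ lra | exact Hdq ] | ].
    apply Req_le; field; generalize (Rabs_pos qx) (Rabs_pos qy); lra. }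
  assert (T2 : Rabs (c * (dq - l)) <= eps / 2 * m).
  { rewrite Rabs_mult.
    assert (Hc := Rabs_pos c).
    apply Rle_trans with (Rabs c * (eps / (2 * (Rabs c + 1)) * m)).
    - apply Rmult_le_compat_l; [ exact Hc | ].
      eapply Rle_trans; [ exact K2 | ].
      apply Rmult_le_compat_r; [ lra | apply Rmin_r ].
    - rewrite <- Rmult_assoc; apply Rmult_le_compat_r; [ lra | ].
      apply (Rmult_le_reg_r (2 * (Rabs c + 1))); [ lra | ].
      replace (Rabs c * (eps / (2 * (Rabs c + 1))) * (2 * (Rabs c + 1)))
        with (Rabs c * eps) by (field; lra).
      destruct eps as [e He]; simpl in *; nra. }
  lra.
Qed.

#[export] Instance from_endpoint_proper (a b : R) : ProperFilter (from_endpoint a b).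
Proof.
  unfold from_endpoint; destruct (total_order_T a b) as [[H|H]|H].
  - apply at_right_proper_filter.
  - apply at_point_filter.
  - apply at_left_proper_filter.
Qed.

(** The sign of [(x - a) * (b - a)] treats both orders of [a] and [b] at once; the other alternative
    is the degenerate filter at [a = b]. *)
Lemma from_endpoint_side (a b : R) (P : R -> Prop) :
  locally a (fun x => a = x /\ a = b \/ 0 < (x - a) * (b - a) -> P x) ->
  from_endpoint a b P.
Proof.
  unfold from_endpoint; intros H; destruct (total_order_T a b) as [[Hab|Hab]|Hab].
  - unfold at_right, at_left, within; revert H; apply filter_imp; intros x HP Hx; apply HP; right.
    apply Rmult_lt_0_compat; lra.
  - apply locally_singleton in H; apply H; now left.
  - unfold at_right, at_left, within; revert H; apply filter_imp; intros x HP Hx; apply HP; right.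
    replace ((x - a) * (b - a)) with ((a - x) * (a - b)) by ring.
    apply Rmult_lt_0_compat; lra.
Qed.

(** Convergence at a singular endpoint reduces to continuity of a primitive: [f] may blow up at [a]
    as long as [H] extends continuously to it. *)
Lemma is_RInt_gen_from_endpoint (f H : R -> R) (a b : R) :
  from_endpoint a b (fun x => is_RInt f x b (H x)) ->
  continuous H a ->
  is_RInt_gen f (from_endpoint a b) (at_point b) (H a).
Proof.
  intros HI HC P HP.
  assert (K : from_endpoint a b (fun x => is_RInt f x b (H x) /\ P (H x))).
  { apply filter_and; [ exact HI | ].
    apply from_endpoint_side; specialize (HC P HP); unfold filtermap in HC; revert HC; apply filter_imp; auto. }
  apply (Filter_prod _ _ _ _ (fun y => y = b) K); [ reflexivity | ].
  intros x y [Hx HPx] ->; now exists (H x).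
Qed.

(** * The squared radial speed *)

Lemma C1_params_opp f q0 : C1_params f q0 -> C1_params (fun q => - f q) q0.
Proof.
  intros H; apply C1_params_ext with (fun q => -1 * f q).
  - apply filter_forall; intros q; ring.
  - apply C1_params_mult; [ apply C1_params_const | exact H ].
Qed.

Lemma C1_params_minus f g q0 :
  C1_params f q0 -> C1_params g q0 -> C1_params (fun q => f q - g q) q0.
Proof.
  intros Hf Hg; apply C1_params_plus; [ exact Hf | now apply C1_params_opp ].
Qed.

Lemma C1_params_pow f n q0 : C1_params f q0 -> C1_params (fun q => f q ^ n) q0.
Proof.
  intros H; induction n as [|n IH]; simpl.
  - apply C1_params_const.
  - now apply C1_params_mult.
Qed.

Lemma C1_params_div f g q0 :
  C1_params f q0 -> C1_params g q0 -> g q0 <> 0 -> C1_params (fun q => f q / g q) q0.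
Proof.
  intros Hf Hg H0; apply C1_params_mult; [ exact Hf | now apply C1_params_inv ].
Qed.

Lemma C1_params_differentiable f (s x y : R) :
  C1_params f (s, (x, y)) -> differentiable_pt (fun u v => f (s, (u, v))) x y.
Proof.
  intros H; exists (dparam1 f (s, (x, y))), (dparam2 f (s, (x, y))); intros eps.
  destruct (C1_params_taylor f s x y eps H) as [d Hd].
  exists d; intros u v Hu Hv; apply (Hd (s, (u, v))).
  split; [ apply ball_center | split; [ exact Hu | exact Hv ] ].
Qed.

Definition speed2 (U : R -> R) (req : R) (q : R * (R * R)) : R :=
  radial_speed2 U req (fst (snd q)) (snd (snd q)) (fst q).
(** Closed forms of the radial derivatives of [speed2] of orders 1 to 3. The third is needed because
    [by_parts] contains the second and is itself differentiated. *)
Definition speed2_1 (U : R -> R) (q : R * (R * R)) : R :=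
  - 2 * Derive U (fst q) + 2 * fst (snd q) ^ 2 / fst q ^ 3.
Definition speed2_2 (U : R -> R) (q : R * (R * R)) : R :=
  - 2 * Derive_n U 2 (fst q) - 6 * fst (snd q) ^ 2 / fst q ^ 4.
Definition speed2_3 (U : R -> R) (q : R * (R * R)) : R :=
  - 2 * Derive_n U 3 (fst q) + 24 * fst (snd q) ^ 2 / fst q ^ 5.

Lemma smooth_is_derive_n (U : R -> R) (n : nat) (s : R) :
  smooth_on_positive U -> 0 < s ->
  is_derive (Derive_n U n) s (Derive_n U (S n) s).
Proof.
  intros HU Hs; apply Derive_correct, (HU (S n) s Hs).
Qed.

Lemma smooth_continuous_n (U : R -> R) (n : nat) (s : R) :
  smooth_on_positive U -> 0 < s -> continuous (Derive_n U n) s.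
Proof.
  intros HU Hs; apply (ex_derive_continuous (V := R_NormedModule)).
  eexists; now apply smooth_is_derive_n.
Qed.

Lemma locally_positive (s : R) : 0 < s -> locally s (fun x => 0 < x).
Proof. intros H; now apply open_gt. Qed.

Lemma is_derive_speed2 U req s p :
  smooth_on_positive U -> 0 < s ->
  is_derive (fun x => speed2 U req (x, p)) s (speed2_1 U (s, p)).
Proof.
  intros HU Hs; unfold speed2, speed2_1, radial_speed2; simpl.
  auto_derive.
  - repeat split; [ exact (HU 1%nat s Hs) | apply Rgt_not_eq; nra ].
  - change (fun x : R => U x) with U; field; lra.
Qed.

Lemma is_derive_speed2_1 U s p :
  smooth_on_positive U -> 0 < s ->
  is_derive (fun x => speed2_1 U (x, p)) s (speed2_2 U (s, p)).
Proof.
  intros HU Hs; unfold speed2_1, speed2_2; cbn [fst snd].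
  change (Derive U) with (Derive_n U 1).
  assert (H := smooth_is_derive_n U 1 s HU Hs).
  set (V := Derive_n U 1) in *; set (V' := Derive_n U 2 s) in *.
  assert (E : Derive V s = V') by now apply is_derive_unique.
  clearbody V.
  auto_derive.
  - repeat split; [ now exists V' | apply Rgt_not_eq; assert (0 < s * s) by nra; nra ].
  - change (fun x : R => V x) with V; rewrite E; field; lra.
Qed.

Lemma is_derive_speed2_2 U s p :
  smooth_on_positive U -> 0 < s ->
  is_derive (fun x => speed2_2 U (x, p)) s (speed2_3 U (s, p)).
Proof.
  intros HU Hs; unfold speed2_2, speed2_3; cbn [fst snd].
  assert (H := smooth_is_derive_n U 2 s HU Hs).
  set (V := Derive_n U 2) in *; set (V' := Derive_n U 3 s) in *.
  assert (E : Derive V s = V') by now apply is_derive_unique.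
  clearbody V.
  auto_derive.
  - repeat split; [ now exists V' | ].
    apply Rgt_not_eq; assert (0 < s * s) by nra; assert (0 < s * (s * s)) by nra; nra.
  - change (fun x : R => V x) with V; rewrite E; field; lra.
Qed.

Lemma C1_params_radius (u : R -> R) (q : R * (R * R)) :
  (forall s, 0 < s -> continuous u s) -> 0 < fst q ->
  C1_params (fun q => u (fst q)) q.
Proof.
  intros Hu Hq; apply C1_params_const_params.
  generalize (locally_positive _ Hq); apply filter_imp; auto.
Qed.

(** The case [f * sqrt f] comes before the general product, because its factor [sqrt f] alone need
    not be of class C1 where [f] vanishes. Nonvanishing of denominators is left to the caller. *)
Ltac C1_tac :=
  lazymatch goal with
  | |- C1_params (fun q => @?f q + @?g q) _ => apply (C1_params_plus f g); C1_tac
  | |- C1_params (fun q => @?f q - @?g q) _ => apply (C1_params_minus f g); C1_tac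
  | |- C1_params (fun q => @?f q * sqrt (@?f q)) _ =>
      apply (C1_params_mult_sqrt f); C1_tac
  | |- C1_params (fun q => @?f q * @?g q) _ => apply (C1_params_mult f g); C1_tac
  | |- C1_params (fun q => @?f q / @?g q) _ => apply (C1_params_div f g); C1_tac
  | |- C1_params (fun q => @?f q ^ ?n) _ => apply (C1_params_pow f n); C1_tac
  | |- C1_params (fun q => fst (snd q)) _ => apply C1_params_fst
  | |- C1_params (fun q => snd (snd q)) _ => apply C1_params_snd
  | |- C1_params _ _ => first [ assumption | apply C1_params_const ]
  | |- _ => idtac
  end.

Lemma C1_params_id (q : R * (R * R)) : 0 < fst q -> C1_params fst q.
Proof.
  intros Hq; apply (C1_params_radius (fun s => s)); [ | exact Hq ].
  intros; apply continuous_id.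
Qed.

Lemma C1_params_speed2 U req q :
  smooth_on_positive U -> 0 < fst q -> C1_params (speed2 U req) q.
Proof.
  intros HU Hq; unfold speed2, radial_speed2.
  assert (HR := C1_params_id q Hq).
  assert (HV : C1_params (fun q => U (fst q)) q)
    by (apply C1_params_radius; [ intros s; now apply (smooth_continuous_n U 0) | easy ]).
  C1_tac; now apply pow_nonzero, Rgt_not_eq.
Qed.

Lemma C1_params_speed2_1 U q :
  smooth_on_positive U -> 0 < fst q -> C1_params (speed2_1 U) q.
Proof.
  intros HU Hq; unfold speed2_1.
  assert (HR := C1_params_id q Hq).
  assert (HV : C1_params (fun q => Derive U (fst q)) q)
    by (apply C1_params_radius; [ intros s; now apply (smooth_continuous_n U 1) | easy ]).
  C1_tac; now apply pow_nonzero, Rgt_not_eq.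
Qed.

Lemma C1_params_speed2_2 U q :
  smooth_on_positive U -> 0 < fst q -> C1_params (speed2_2 U) q.
Proof.
  intros HU Hq; unfold speed2_2.
  assert (HR := C1_params_id q Hq).
  assert (HV : C1_params (fun q => Derive_n U 2 (fst q)) q)
    by (apply C1_params_radius; [ intros s; now apply (smooth_continuous_n U 2) | easy ]).
  C1_tac; now apply pow_nonzero, Rgt_not_eq.
Qed.

Lemma C1_params_speed2_3 U q :
  smooth_on_positive U -> 0 < fst q -> C1_params (speed2_3 U) q.
Proof.
  intros HU Hq; unfold speed2_3.
  assert (HR := C1_params_id q Hq).
  assert (HV : C1_params (fun q => Derive_n U 3 (fst q)) q)
    by (apply C1_params_radius; [ intros s; now apply (smooth_continuous_n U 3) | easy ]).
  C1_tac; now apply pow_nonzero, Rgt_not_eq.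
Qed.

(** The weights in use are [sg] for [T] and [sg / s ^ 2] for [Theta]. Each integration by parts
    differentiates the weight once, and the last derivative only has to be continuous since it stays
    under the integral. *)
Definition is_weight (w w1 w2 : R -> R) : Prop :=
  forall s, 0 < s ->
    is_derive w s (w1 s) /\ is_derive w1 s (w2 s) /\ continuous w2 s.

Definition weighted U req (w : R -> R) (q : R * (R * R)) : R :=
  w (fst q) / sqrt (speed2 U req q).

(* Two integrations by parts, first of [g' / sqrt g] against [w / g'] and then
   of [g' * sqrt g] against [(w / g')' / g'], write [w / sqrt g] near a simple
   zero of [g] as the derivative of [by_parts] plus [4 / 3] times [remainder].
   The former vanishes at the zero, and the latter, vanishing beyond it, is of
   class C1 in the parameters. *)
Definition by_parts U req (w w1 : R -> R) (q : R * (R * R)) : R :=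
  2 * sqrt (speed2 U req q) * (w (fst q) / speed2_1 U q)
  - 4 / 3 * (speed2 U req q * sqrt (speed2 U req q))
    * (w1 (fst q) / speed2_1 U q ^ 2
       - w (fst q) * speed2_2 U q / speed2_1 U q ^ 3).

Definition remainder U req (w w1 w2 : R -> R) (q : R * (R * R)) : R :=
  speed2 U req q * sqrt (speed2 U req q)
  * (w2 (fst q) / speed2_1 U q ^ 2
     - 3 * w1 (fst q) * speed2_2 U q / speed2_1 U q ^ 3
     - w (fst q) * speed2_3 U q / speed2_1 U q ^ 3
     + 3 * w (fst q) * speed2_2 U q ^ 2 / speed2_1 U q ^ 4).

Lemma weight_continuous w w1 w2 s :
  is_weight w w1 w2 -> 0 < s -> continuous w s /\ continuous w1 s /\ continuous w2 s.
Proof.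
  intros H Hs; destruct (H s Hs) as [H0 [H1 H2]]; repeat split; [ | | exact H2 ];
    apply (ex_derive_continuous (V := R_NormedModule)); eexists; eassumption.
Qed.

(** The constants come from [(2 sqrt g)' = g' / sqrt g] and [(2/3 g sqrt g)' = g' sqrt g]. The last
    bracket of [by_parts] is [(w / g')' / g'], and that of [remainder] is its derivative; the two
    terms in [sqrt g] cancel. *)
Lemma is_derive_by_parts U req w w1 w2 s p :
  smooth_on_positive U -> is_weight w w1 w2 -> 0 < s ->
  0 < speed2 U req (s, p) -> speed2_1 U (s, p) <> 0 ->
  is_derive (fun x => by_parts U req w w1 (x, p)) s
    (weighted U req w (s, p) - 4 / 3 * remainder U req w w1 w2 (s, p)).
Proof.
  intros HU Hw Hs Hg Hg1.
  unfold by_parts, weighted, remainder; cbn [fst].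
  assert (D0 := is_derive_speed2 U req s p HU Hs).
  assert (D1 := is_derive_speed2_1 U s p HU Hs).
  assert (D2 := is_derive_speed2_2 U s p HU Hs).
  destruct (Hw s Hs) as [W0 [W1 _]].
  set (d3 := speed2_3 U (s, p)) in *; clearbody d3.
  set (g := fun x => speed2 U req (x, p)) in *.
  set (g1 := fun x => speed2_1 U (x, p)) in *.
  set (g2 := fun x => speed2_2 U (x, p)) in *.
  change (speed2 U req (s, p)) with (g s) in *.
  change (speed2_1 U (s, p)) with (g1 s) in *.
  change (speed2_2 U (s, p)) with (g2 s) in *.
  apply is_derive_ext with (fun x =>
    2 * sqrt (g x) * (w x / g1 x)
    - 4 / 3 * (g x * sqrt (g x)) * (w1 x / g1 x ^ 2 - w x * g2 x / g1 x ^ 3));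
    [ reflexivity | ].
  change (is_derive g s (g1 s)) in D0.
  change (is_derive g1 s (g2 s)) in D1.
  change (is_derive g2 s d3) in D2.
  clearbody g g1 g2.
  assert (E0 := is_derive_unique _ _ _ D0).
  assert (E1 := is_derive_unique _ _ _ D1).
  assert (E2 := is_derive_unique _ _ _ D2).
  assert (F0 := is_derive_unique _ _ _ W0).
  assert (F1 := is_derive_unique _ _ _ W1).
  assert (N2 : g1 s * (g1 s * 1) <> 0) by (now apply (pow_nonzero _ 2)).
  assert (N3 : g1 s * (g1 s * (g1 s * 1)) <> 0) by (now apply (pow_nonzero _ 3)).
  auto_derive.
  - repeat split; try assumption; eexists; eassumption.
  - change (fun x : R => g x) with g; change (fun x : R => g1 x) with g1.
    change (fun x : R => g2 x) with g2; change (fun x : R => w x) with w.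
    change (fun x : R => w1 x) with w1; rewrite E0, E1, E2, F0, F1.
    assert (Hq := sqrt_lt_R0 _ Hg).
    assert (Hqq := sqrt_sqrt (g s) (Rlt_le _ _ Hg)).
    (* Writing [g s] as [r * r] makes the identity rational, hence accessible to [field]. *)
    set (r := sqrt (g s)) in *; clearbody r; rewrite <- Hqq.
    field; split; lra.
Qed.

Lemma C1_params_weighted U req w w1 w2 q :
  smooth_on_positive U -> is_weight w w1 w2 -> 0 < fst q -> 0 < speed2 U req q ->
  C1_params (weighted U req w) q.
Proof.
  intros HU Hw Hq Hg.
  apply (C1_params_div (fun q => w (fst q)) (fun q => sqrt (speed2 U req q))).
  - apply C1_params_radius; [ | exact Hq ]; intros s Hs.
    apply (weight_continuous _ _ _ _ Hw Hs).
  - apply C1_params_sqrt; [ now apply C1_params_speed2 | exact Hg ].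
  - now apply Rgt_not_eq, sqrt_lt_R0.
Qed.

(** Unlike for [weighted], the sign of [g] is free: [g] enters undifferentiated only through
    [g * sqrt g], which is of class C1 across the zero. *)
Lemma C1_params_remainder U req w w1 w2 q :
  smooth_on_positive U -> is_weight w w1 w2 -> 0 < fst q -> speed2_1 U q <> 0 ->
  C1_params (remainder U req w w1 w2) q.
Proof.
  intros HU Hw Hq Hg1; unfold remainder.
  assert (G0 := C1_params_speed2 U req q HU Hq).
  assert (G1 := C1_params_speed2_1 U q HU Hq).
  assert (G2 := C1_params_speed2_2 U q HU Hq).
  assert (G3 := C1_params_speed2_3 U q HU Hq).
  assert (W0 : C1_params (fun q => w (fst q)) q) by
    (apply C1_params_radius; [ intros; now apply (weight_continuous _ _ _ _ Hw) | easy ]).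
  assert (W1 : C1_params (fun q => w1 (fst q)) q) by
    (apply C1_params_radius; [ intros; now apply (weight_continuous _ _ _ _ Hw) | easy ]).
  assert (W2 : C1_params (fun q => w2 (fst q)) q) by
    (apply C1_params_radius; [ intros; now apply (weight_continuous _ _ _ _ Hw) | easy ]).
  C1_tac; first [ assumption | now apply pow_nonzero | discrR ].
Qed.

(* [sqrt g] and the remaining factors of [by_parts] are treated separately, as
   only the latter are of class C1 at a zero of [g]. *)
Lemma by_parts_continuous U req w w1 w2 q :
  smooth_on_positive U -> is_weight w w1 w2 -> 0 < fst q -> speed2_1 U q <> 0 ->
  continuous (by_parts U req w w1) q /\
  (0 < speed2 U req q -> C1_params (by_parts U req w w1) q).
Proof.
  intros HU Hw Hq Hg1; unfold by_parts.
  assert (G0 := C1_params_speed2 U req q HU Hq).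
  assert (G1 := C1_params_speed2_1 U q HU Hq).
  assert (G2 := C1_params_speed2_2 U q HU Hq).
  assert (W0 : C1_params (fun q => w (fst q)) q) by
    (apply C1_params_radius; [ intros; now apply (weight_continuous _ _ _ _ Hw) | easy ]).
  assert (W1 : C1_params (fun q => w1 (fst q)) q) by
    (apply C1_params_radius; [ intros; now apply (weight_continuous _ _ _ _ Hw) | easy ]).
  assert (CC : forall f, C1_params f q -> continuous f q)
    by (intros f Hf; eapply locally_singleton, C1_params_continuous, Hf).
  split.
  - apply (continuous_minus
      (fun q => 2 * sqrt (speed2 U req q) * (w (fst q) / speed2_1 U q))).
    + apply (continuous_mult (fun q => 2 * sqrt (speed2 U req q))).
      * apply (continuous_mult (fun _ => 2) (fun q => sqrt (speed2 U req q)));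
          [ apply continuous_const | ].
        apply (continuous_comp (speed2 U req) sqrt); [ now apply CC | ].
        apply continuous_sqrt.
      * now apply CC; C1_tac.
    + apply CC; C1_tac; first [ assumption | now apply pow_nonzero | discrR ].
  - intros Hg; assert (S := C1_params_sqrt _ _ G0 Hg).
    C1_tac; first [ assumption | now apply pow_nonzero | discrR ].
Qed.

(** * Total differentiability of sums and products *)

Lemma differentiable_pt_lim_plus f g x y fx fy gx gy :
  differentiable_pt_lim f x y fx fy -> differentiable_pt_lim g x y gx gy ->
  differentiable_pt_lim (fun u v => f u v + g u v) x y (fx + gx) (fy + gy).
Proof.
  intros Hf Hg.
  replace (fx + gx) with (1 * fx + 1 * gx) by ring.
  replace (fy + gy) with (1 * fy + 1 * gy) by ring.
  apply (differentiable_pt_lim_comp (fun u v => u + v)); [ | exact Hf | exact Hg ].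
  intros eps; exists eps; intros u v _ _.
  replace (u + v - _ - _) with 0 by ring; rewrite Rabs_R0.
  apply Rmult_le_pos; [ apply Rlt_le, cond_pos | ].
  eapply Rle_trans; [ apply Rabs_pos | apply Rmax_l ].
Qed.

Lemma differentiable_pt_lim_mult f g x y fx fy gx gy :
  differentiable_pt_lim f x y fx fy -> differentiable_pt_lim g x y gx gy ->
  differentiable_pt_lim (fun u v => f u v * g u v) x y
    (g x y * fx + f x y * gx) (g x y * fy + f x y * gy).
Proof.
  intros Hf Hg.
  apply (differentiable_pt_lim_comp (fun u v => u * v)); [ | exact Hf | exact Hg ].
  intros eps; exists eps; intros u v Hu Hv.
  set (c := f x y) in *; set (d := g x y) in *.
  replace (u * v - _ - _) with ((u - c) * (v - d)) by ring; rewrite Rabs_mult.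
  apply Rmult_le_compat; try apply Rabs_pos; [ lra | apply Rmax_r ].
Qed.

Lemma differentiable_pt_lim_const c x y :
  differentiable_pt_lim (fun _ _ => c) x y 0 0.
Proof.
  intros eps; exists eps; intros u v _ _.
  replace (c - c - _) with 0 by ring; rewrite Rabs_R0.
  apply Rmult_le_pos; [ apply Rlt_le, cond_pos | ].
  eapply Rle_trans; [ apply Rabs_pos | apply Rmax_l ].
Qed.

Lemma differentiable_pt_plus f g x y :
  differentiable_pt f x y -> differentiable_pt g x y ->
  differentiable_pt (fun u v => f u v + g u v) x y.
Proof.
  intros [fx [fy Hf]] [gx [gy Hg]]; do 2 eexists.
  apply differentiable_pt_lim_plus; eassumption.
Qed.

Lemma differentiable_pt_mult f g x y :
  differentiable_pt f x y -> differentiable_pt g x y ->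
  differentiable_pt (fun u v => f u v * g u v) x y.
Proof.
  intros [fx [fy Hf]] [gx [gy Hg]]; do 2 eexists.
  apply differentiable_pt_lim_mult; eassumption.
Qed.

Lemma differentiable_pt_const c x y : differentiable_pt (fun _ _ => c) x y.
Proof. exists 0, 0; apply differentiable_pt_lim_const. Qed.

Lemma differentiable_pt_scal c f x y :
  differentiable_pt f x y -> differentiable_pt (fun u v => c * f u v) x y.
Proof.
  apply (differentiable_pt_mult (fun _ _ => c)), differentiable_pt_const.
Qed.

Lemma differentiable_pt_ext_loc f g x y :
  locally_2d (fun u v => f u v = g u v) x y ->
  differentiable_pt f x y -> differentiable_pt g x y.
Proof.
  intros E [fx [fy Hf]]; exists fx, fy; now apply differentiable_pt_lim_ext with f.
Qed.

Lemma filterlim_id_pair (x y : R) :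
  filterlim (fun z : R * R => (fst z, snd z)) (locally (x, y)) (locally (x, y)).
Proof.
  intros P HP; unfold filtermap; revert HP; apply filter_imp; intros [u v]; auto.
Qed.

(** A point of the perturbed segment lies on the original one or close to one of its endpoints,
    where the hypothesis holds on a ball. *)
Lemma locally_segment_endpoints (P : R * (R * R) -> Prop) (a b x0 y0 : R) :
  (forall s, Rmin a b <= s <= Rmax a b -> locally (s, (x0, y0)) P) ->
  exists d : posreal, forall a' b' x y,
    Rabs (a' - a) < d -> Rabs (b' - b) < d -> Rabs (x - x0) < d -> Rabs (y - y0) < d ->
    forall s, Rmin a' b' <= s <= Rmax a' b' -> P (s, (x, y)).
Proof.
  intros H.
  destruct (locally_forall_segment _ P a b (x0, y0) H) as [d1 H1].
  assert (Ha := H a (conj (Rmin_l _ _) (Rmax_l _ _))).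
  assert (Hb := H b (conj (Rmin_r _ _) (Rmax_r _ _))).
  apply locally_ball3 in Ha; destruct Ha as [d2 H2].
  apply locally_ball3 in Hb; destruct Hb as [d3 H3].
  exists (mkposreal _ (Rmin_pos _ _ (cond_pos d1)
            (Rmin_pos _ _ (cond_pos d2) (cond_pos d3)))); simpl.
  intros a' b' x y Ka Kb Kx Ky s Hs.
  assert (M1 := Rmin_l d1 (Rmin d2 d3)).
  assert (M2 := Rle_trans _ _ _ (Rmin_r d1 (Rmin d2 d3)) (Rmin_l d2 d3)).
  assert (M3 := Rle_trans _ _ _ (Rmin_r d1 (Rmin d2 d3)) (Rmin_r d2 d3)).
  set (d := Rmin d1 (Rmin d2 d3)) in *.
  assert (C : Rmin a b <= s <= Rmax a b \/ Rabs (s - a) < d \/ Rabs (s - b) < d).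
  { revert Hs Ka Kb; clear; unfold Rmin, Rmax, Rabs.
    destruct (Rle_dec a b), (Rle_dec a' b'), (Rcase_abs (a' - a)),
      (Rcase_abs (b' - b)), (Rcase_abs (s - a)), (Rcase_abs (s - b)); lra. }
  destruct C as [C|[C|C]].
  - apply (H1 (x, y)); [ | exact C ].
    split; (eapply Rlt_le_trans; [ | exact M1 ]); assumption.
  - apply H2; lra.
  - apply H3; lra.
Qed.

(** All dependence on the possibly singular endpoint [r0 x y] is put into [A]; what remains is a
    proper integral over a short segment. Validity for all nearby [b'], [x], [y] together is what
    allows following a curve. *)
Definition integral_expansion (f : R * (R * R) -> R) (r0 A : R -> R -> R)
    (b x0 y0 : R) : Prop :=
  differentiable_pt A x0 y0 /\
  exists d : posreal, forall b' x y,
    Rabs (b' - b) < d -> Rabs (x - x0) < d -> Rabs (y - y0) < d ->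
    is_RInt_gen (fun s => f (s, (x, y))) (from_endpoint (r0 x y) b') (at_point b')
      (A x y + RInt (fun s => f (s, (x, y))) b b').

(** The integral from [r0 x y] to [b] is the one from the fixed [a0], differentiated under the
    integral sign, minus the one from [a0] to [r0 x y], in which only the endpoint counts to first
    order. *)
Lemma integral_from_regular_point f (r0 : R -> R -> R) (b x0 y0 : R) :
  differentiable_pt r0 x0 y0 ->
  (forall s, Rmin (r0 x0 y0) b <= s <= Rmax (r0 x0 y0) b -> C1_params f (s, (x0, y0))) ->
  exists A, integral_expansion f r0 A b x0 y0.
Proof.
  intros Hr0 Hf.
  set (a0 := r0 x0 y0) in *.
  exists (fun x y => RInt (fun s => f (s, (x, y))) (r0 x y) b).
  destruct (locally_segment_endpoints (continuous f) a0 b x0 y0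
              (fun s Hs => C1_params_continuous _ _ (Hf s Hs))) as [d1 H1].
  (* Half the radius, so that points within [d1 / 2] of [r0 x y] are still within [d1] of [a0]. *)
  assert (Hd2 : 0 < d1 / 2) by (generalize (cond_pos d1); lra).
  destruct (differentiable_continuity_pt _ _ _ Hr0 (mkposreal _ Hd2)) as [d2 H2].
  fold a0 in H2; simpl in H2.
  assert (I : forall a b' x y,
    Rabs (a - a0) < d1 -> Rabs (b' - b) < d1 -> Rabs (x - x0) < d1 -> Rabs (y - y0) < d1 ->
    ex_RInt (fun s => f (s, (x, y))) a b').
  { intros a b' x y K1 K2 K3 K4; apply (ex_RInt_section f).
    intros s Hs; now apply (H1 a b' x y). }
  assert (R1 : forall z : R, Rabs (z - z) < d1)
    by (intros z; rewrite Rminus_diag, Rabs_R0; apply cond_pos).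
  assert (M1 := Rmin_l d1 d2); assert (M2 := Rmin_r d1 d2).
  split.
  - apply differentiable_pt_ext_loc with (fun x y =>
      RInt (fun s => f (s, (x, y))) a0 b
      + -1 * RInt (fun s => f (s, (x, y))) a0 (r0 x y)).
    + exists (mkposreal _ (Rmin_pos _ _ (cond_pos d1) (cond_pos d2))); simpl.
      intros x y Hx Hy.
      assert (Ha : Rabs (r0 x y - a0) < d1 / 2) by (apply H2; lra).
      assert (I1 : ex_RInt (fun s => f (s, (x, y))) a0 b) by (apply I; auto; lra).
      assert (I2 : ex_RInt (fun s => f (s, (x, y))) (r0 x y) b) by (apply I; auto; lra).
      rewrite <- (RInt_Chasles _ a0 (r0 x y) b); [ | | exact I2 ].
      * unfold plus; simpl; ring.
      * eapply ex_RInt_Chasles; [ exact I1 | now apply ex_RInt_swap ].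
    + apply differentiable_pt_plus.
      * now apply differentiable_RInt_params.
      * apply differentiable_pt_scal.
        destruct Hr0 as [qx [qy Hq]]; do 2 eexists.
        apply (differentiable_RInt_endpoint f r0 (fun x y => (x, y))); [ | exact Hq | ].
        -- apply C1_params_continuous, Hf; split; [ apply Rmin_l | apply Rmax_l ].
        -- apply filterlim_id_pair.
  - exists (mkposreal _ (Rmin_pos _ _ (cond_pos d1) (cond_pos d2))); simpl.
    intros b' x y Hb Hx Hy.
    assert (Ha : Rabs (r0 x y - a0) < d1 / 2) by (apply H2; lra).
    set (a := r0 x y) in *.
    assert (I1 : ex_RInt (fun s => f (s, (x, y))) a b) by (apply I; auto; lra).
    assert (I2 : ex_RInt (fun s => f (s, (x, y))) a b') by (apply I; auto; lra).
    assert (E := RInt_Chasles _ a b b' I1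
      (ex_RInt_Chasles _ _ _ _ (ex_RInt_swap _ _ _ I1) I2)).
    unfold plus in E; simpl in E; rewrite E; clear E.
    assert (N : locally a (fun z => is_RInt (fun s => f (s, (x, y))) z b'
                                      (RInt (fun s => f (s, (x, y))) z b'))).
    { exists (mkposreal _ Hd2); intros z Hz; change (Rabs (z - a) < d1 / 2) in Hz.
      apply (RInt_correct (V := R_CompleteNormedModule)), I; try lra.
      replace (z - a0) with ((z - a) + (a - a0)) by ring.
      eapply Rle_lt_trans; [ apply Rabs_triang | lra ]. }
    apply (is_RInt_gen_from_endpoint _ (fun z => RInt (fun s => f (s, (x, y))) z b')).
    + apply from_endpoint_side; revert N; apply filter_imp; auto.
    + apply (ex_derive_continuous (V := R_NormedModule)); eexists.
      apply (is_derive_RInt' _ _ _ b' N).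
      apply (continuous_section f), (H1 a b' x y); try lra.
      split; [ apply Rmin_l | apply Rmax_l ].
Qed.

(** * Integrals from a turning point *)

Lemma Rmult_pos_cases (x y : R) : 0 < x * y -> 0 < x /\ 0 < y \/ x < 0 /\ y < 0.
Proof.
  intros H; destruct (Rtotal_order x 0) as [Hx|[Hx|Hx]]; [ right | | left ]; nra.
Qed.

(** The fundamental theorem of calculus for [by_parts], on a closed segment where [g > 0]; the zero
    itself is reached later by a limit. *)
Lemma is_RInt_weighted U req w w1 w2 a b p :
  smooth_on_positive U -> is_weight w w1 w2 ->
  (forall s, Rmin a b <= s <= Rmax a b ->
     0 < s /\ 0 < speed2 U req (s, p) /\ speed2_1 U (s, p) <> 0) ->
  is_RInt (fun s => weighted U req w (s, p)) a b
    (by_parts U req w w1 (b, p) - by_parts U req w w1 (a, p)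
     + 4 / 3 * RInt (fun s => remainder U req w w1 w2 (s, p)) a b).
Proof.
  intros HU Hw H.
  assert (C : forall s, Rmin a b <= s <= Rmax a b ->
    continuous (weighted U req w) (s, p) /\
    continuous (remainder U req w w1 w2) (s, p)).
  { intros s Hs; destruct (H s Hs) as [Hs0 [Hg Hg1]].
    split; eapply locally_singleton, C1_params_continuous;
      [ eapply C1_params_weighted | apply C1_params_remainder ]; eassumption. }
  assert (IK : ex_RInt (fun s => remainder U req w w1 w2 (s, p)) a b)
    by (apply (ex_RInt_section (remainder U req w w1 w2)); intros s Hs; apply (C s Hs)).
  assert (IF := is_RInt_derive (V := R_CompleteNormedModule)
    (fun s => by_parts U req w w1 (s, p))
    (fun s => weighted U req w (s, p) - 4 / 3 * remainder U req w w1 w2 (s, p)) a b).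
  assert (J := is_RInt_plus _ _ _ _ _ _
    (IF (fun s Hs => is_derive_by_parts U req w w1 w2 s p HU Hw (proj1 (H s Hs))
           (proj1 (proj2 (H s Hs))) (proj2 (proj2 (H s Hs))))
        (fun s Hs => continuous_minus (fun s => weighted U req w (s, p)) _ s
           (continuous_section (weighted U req w) s p (proj1 (C s Hs)))
           (continuous_mult (fun _ => 4 / 3) _ s (continuous_const _ _)
             (continuous_section (remainder U req w w1 w2) s p (proj2 (C s Hs))))))
    (is_RInt_scal _ _ _ (4 / 3) _ (RInt_correct _ _ _ IK))).
  eapply is_RInt_ext; [ | exact J ].
  intros s _; unfold plus, scal; simpl; unfold mult; simpl; ring.
Qed.

(* The integral of [remainder] may start on the far side [c0] of the zero,
   where [remainder] vanishes. *)
Lemma integral_from_zero U req w w1 w2 (r0 : R -> R -> R) (b x0 y0 : R) :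
  smooth_on_positive U -> is_weight w w1 w2 ->
  continuity_2d_pt r0 x0 y0 ->
  locally_2d (fun x y => speed2 U req (r0 x y, (x, y)) = 0) x0 y0 ->
  0 < r0 x0 y0 -> speed2_1 U (r0 x0 y0, (x0, y0)) <> 0 ->
  0 < b -> 0 < speed2 U req (b, (x0, y0)) ->
  (forall s, Rmin (r0 x0 y0) b < s < Rmax (r0 x0 y0) b ->
     0 < speed2 U req (s, (x0, y0))) ->
  exists A, integral_expansion (weighted U req w) r0 A b x0 y0.
Proof.
  intros HU Hw Hr0 Hz Ha0 Hg1 Hb Hgb Hpos.
  assert (Hz0 : speed2 U req (r0 x0 y0, (x0, y0)) = 0)
    by exact (locally_2d_singleton _ _ _ Hz).
  set (a0 := r0 x0 y0) in *; set (p0 := (x0, y0)) in *.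
  assert (Hne : b - a0 <> 0).
  { intros E; replace b with a0 in Hgb by lra; lra. }
  (* The derivative of [g] keeps its sign near the zero; the product covers both signs, that is,
     zeros on either side of [b]. *)
  assert (B1 : locally (a0, p0)
      (fun q => 0 < fst q /\ 0 < speed2_1 U q * speed2_1 U (a0, p0))).
  { apply filter_and.
    - exact (continuous_fst a0 p0 _ (locally_positive a0 Ha0)).
    - assert (C : continuous (speed2_1 U) (a0, p0))
        by (eapply locally_singleton, C1_params_continuous, C1_params_speed2_1; easy).
      set (m := speed2_1 U (a0, p0)) in *.
      specialize (C _ (locally_ball m (mkposreal _ (Rabs_pos_lt _ Hg1)))).
      unfold filtermap in C; revert C; apply filter_imp; intros q Hq.
      change (Rabs (speed2_1 U q - m) < Rabs m) in Hq.
      revert Hq; unfold Rabs; do 2 destruct Rcase_abs; intros; nra. }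
  apply locally_ball3 in B1; destruct B1 as [d1 B1].
  (* [h] is a signed step from [a0] towards [b]. Both [a0 + h], strictly before [b], and its mirror
     image [a0 - h] stay where [g'] keeps its sign. *)
  assert (Hh : exists h, (0 < h < b - a0 \/ b - a0 < h < 0) /\ Rabs h < d1).
  { assert (K := Rmin_pos _ _ (cond_pos d1) (Rabs_pos_lt _ Hne)).
    assert (K1 := Rmin_l d1 (Rabs (b - a0))); assert (K2 := Rmin_r d1 (Rabs (b - a0))).
    set (e := Rmin d1 (Rabs (b - a0))) in *.
    destruct (Rdichotomy _ _ Hne).
    - exists (- (e / 2)); rewrite (Rabs_left (b - a0)) in K2 by lra.
      rewrite Rabs_left; lra.
    - exists (e / 2); rewrite (Rabs_pos_eq (b - a0)) in K2 by lra.
      rewrite Rabs_pos_eq; lra. }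
  destruct Hh as [h [Hh Hh1]].
  assert (R1 : forall z : R, Rabs (z - z) < d1)
    by (intros z; rewrite Rminus_diag, Rabs_R0; apply cond_pos).
  set (c := a0 + h).
  assert (Hc1 : Rabs (c - a0) < d1) by (unfold c; replace (a0 + h - a0) with h by ring; easy).
  assert (MV : forall s a x y, Rabs (s - a0) < d1 -> Rabs (a - a0) < d1 ->
     Rabs (x - x0) < d1 -> Rabs (y - y0) < d1 -> speed2 U req (a, (x, y)) = 0 ->
     exists m, 0 < m * speed2_1 U (a0, p0) /\ speed2 U req (s, (x, y)) = m * (s - a)).
  { intros s a x y Ks Ka Kx Ky E.
    assert (D : forall z, Rmin a s <= z <= Rmax a s -> Rabs (z - a0) < d1).
    { intros z; revert Ks Ka; unfold Rmin, Rmax, Rabs.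
      destruct (Rle_dec a s), (Rcase_abs (s - a0)), (Rcase_abs (a - a0)),
        (Rcase_abs (z - a0)); lra. }
    destruct (MVT_gen (fun z => speed2 U req (z, (x, y))) a s
                (fun z => speed2_1 U (z, (x, y)))) as [z [Hz1 Ez]].
    - intros z Hz'; apply is_derive_speed2; [ exact HU | ].
      apply (B1 z x y); auto; apply D; lra.
    - intros z Hz'; apply derivable_continuous_pt; eexists.
      apply is_derive_Reals, is_derive_speed2; [ exact HU | ].
      apply (B1 z x y); auto.
    - exists (speed2_1 U (z, (x, y))); split.
      + apply (B1 z x y); auto.
      + simpl in Ez; lra. }
  (* As [g] vanishes at [a0] and is positive at [c], it increases in the direction of [h]. *)
  assert (Sg : 0 < speed2_1 U (a0, p0) * h).
  { assert (Hgc : 0 < speed2 U req (c, p0)).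
    { apply Hpos; unfold c, Rmin, Rmax; destruct (Rle_dec a0 b), Hh; lra. }
    destruct (MV c a0 x0 y0) as [m [Hm Em]]; auto.
    unfold p0 in Hgc; rewrite Em in Hgc; replace (c - a0) with h in Hgc by (unfold c; ring).
    destruct Hh; nra. }
  assert (Sgn : forall s a x y, Rabs (s - a0) < d1 -> Rabs (a - a0) < d1 ->
     Rabs (x - x0) < d1 -> Rabs (y - y0) < d1 -> speed2 U req (a, (x, y)) = 0 ->
     (0 < (s - a) * h -> 0 < speed2 U req (s, (x, y))) /\
     ((s - a) * h <= 0 -> speed2 U req (s, (x, y)) <= 0)).
  { intros s a x y Ks Ka Kx Ky E; destruct (MV s a x y) as [m [Hm Em]]; auto.
    rewrite Em; assert (0 < m * h) by (destruct Hh; nra).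
    destruct Hh; split; nra. }
  destruct (locally_segment_endpoints
      (fun q => continuous (weighted U req w) q) c b x0 y0) as [d2 B2].
  { intros s Hs; apply C1_params_continuous; eapply C1_params_weighted; try eassumption.
    - unfold fst; revert Hs; unfold c, Rmin; destruct (Rle_dec (a0 + h) b), Hh; lra.
    - destruct (Req_dec s b) as [->|Hsb]; [ exact Hgb | ]; apply Hpos.
      revert Hs; unfold c, Rmin, Rmax.
      destruct (Rle_dec (a0 + h) b), (Rle_dec a0 b), Hh; lra. }
  assert (Hd3 : 0 < Rabs h) by (apply Rabs_pos_lt; destruct Hh; lra).
  destruct (Hr0 (mkposreal _ Hd3)) as [d3 B3]; fold a0 in B3; simpl in B3.
  destruct Hz as [d4 B4].
  assert (Hd5 : 0 < Rabs (b - c))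
    by (apply Rabs_pos_lt; unfold c; destruct Hh; lra).
  (* No [r0] occurs in this function: the boundary term at [r0] is zero and the integral of
     [remainder] starts at the fixed point [a0 - h]. Its differentiability thus comes from the
     integrands alone. *)
  exists (fun x y => by_parts U req w w1 (c, (x, y))
    + 4 / 3 * RInt (fun s => remainder U req w w1 w2 (s, (x, y))) (a0 - h) c
    + RInt (fun s => weighted U req w (s, (x, y))) c b).
  assert (Near : forall s, Rmin (a0 - h) c <= s <= Rmax (a0 - h) c -> Rabs (s - a0) < d1).
  { intros s; revert Hh1; unfold c, Rmin, Rmax, Rabs.
    destruct (Rle_dec (a0 - h) (a0 + h)), (Rcase_abs h), (Rcase_abs (s - a0)); lra. }
  assert (CK : forall s x y, Rabs (s - a0) < d1 -> Rabs (x - x0) < d1 ->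
     Rabs (y - y0) < d1 -> 0 < s /\ speed2_1 U (s, (x, y)) <> 0 /\
     C1_params (remainder U req w w1 w2) (s, (x, y))).
  { intros s x y Ks Kx Ky; destruct (B1 s x y) as [P1 P2]; auto; simpl in P1.
    assert (N : speed2_1 U (s, (x, y)) <> 0) by (intros E; rewrite E in P2; lra).
    split; [ exact P1 | split; [ exact N | ] ]; apply C1_params_remainder; auto. }
  split.
  - apply differentiable_pt_plus; [ apply differentiable_pt_plus | ].
    + apply C1_params_differentiable.
      destruct (CK c x0 y0) as [P1 [P2 _]]; auto.
      apply (by_parts_continuous U req w w1 w2); auto.
      destruct (Sgn c a0 x0 y0) as [K _]; auto; apply K.
      unfold c; destruct Hh; nra.
    + apply differentiable_pt_scal, differentiable_RInt_params.
      intros s Hs; apply CK; auto.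
    + apply differentiable_RInt_params; intros s Hs.
      eapply C1_params_weighted; try eassumption.
      * unfold fst; revert Hs; unfold c, Rmin; destruct (Rle_dec (a0 + h) b), Hh; lra.
      * destruct (Req_dec s b) as [->|Hsb]; [ exact Hgb | ]; apply Hpos.
        revert Hs; unfold c, Rmin, Rmax.
        destruct (Rle_dec (a0 + h) b), (Rle_dec a0 b), Hh; lra.
  - set (d := Rmin d1 (Rmin d2 (Rmin d3 (Rmin d4 (Rabs (b - c)))))).
    assert (Hd : 0 < d)
      by (repeat apply Rmin_pos; try apply cond_pos; exact Hd5).
    assert (L : d <= d1 /\ d <= d2 /\ d <= d3 /\ d <= d4 /\ d <= Rabs (b - c)).
    { unfold d, Rmin; repeat destruct Rle_dec; lra. }
    clearbody d; exists (mkposreal d Hd); simpl; intros b' x y Kb Kx Ky.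
    assert (Za := B4 x y ltac:(lra) ltac:(lra)).
    assert (Ka := B3 x y ltac:(lra) ltac:(lra)).
    set (a := r0 x y) in *; set (p := (x, y)) in *.
    assert (Sb : 0 < (b' - a) * h).
    { assert (0 < b' - a /\ 0 < h \/ b' - a < 0 /\ h < 0); [ | clear - H; nra ].
      assert (Kb' : Rabs (b' - b) < Rabs (b - c)) by lra.
      revert Kb' Ka; clear - Hh; unfold c, Rabs.
      destruct (Rcase_abs (b' - b)), (Rcase_abs (b - (a0 + h))),
        (Rcase_abs (a - a0)), (Rcase_abs h), Hh; lra. }
    assert (R2 : forall z : R, Rabs (z - z) < d2)
      by (intros z; rewrite Rminus_diag, Rabs_R0; apply cond_pos).
    assert (I1 : ex_RInt (fun s => weighted U req w (s, p)) c b).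
    { apply (ex_RInt_section (weighted U req w)); intros s Hs.
      apply (B2 c b x y); auto; lra. }
    assert (I2 : ex_RInt (fun s => weighted U req w (s, p)) c b').
    { apply (ex_RInt_section (weighted U req w)); intros s Hs.
      apply (B2 c b' x y); auto; lra. }
    assert (I3 := ex_RInt_Chasles _ _ _ _ (ex_RInt_swap _ _ _ I1) I2).
    assert (IR : forall u v, Rabs (u - a0) < d1 -> Rabs (v - a0) < d1 ->
      ex_RInt (fun s => remainder U req w w1 w2 (s, p)) u v).
    { intros u v Ku Kv; apply (ex_RInt_section (remainder U req w w1 w2)); intros s Hs.
      eapply locally_singleton, C1_params_continuous, CK; try lra.
      revert Hs Ku Kv; unfold Rmin, Rmax, Rabs.
      destruct (Rle_dec u v), (Rcase_abs (u - a0)), (Rcase_abs (v - a0)),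
        (Rcase_abs (s - a0)); lra. }
    assert (Ka1 : Rabs (a - a0) < d1) by lra.
    (* For [z] beyond the zero this is the proper integral from [z] to [b']; it is continuous up to
       the zero [a], and [H a] is the improper integral. *)
    set (H := fun z => by_parts U req w w1 (c, p) - by_parts U req w w1 (z, p)
      + 4 / 3 * RInt (fun s => remainder U req w w1 w2 (s, p)) z c
      + RInt (fun s => weighted U req w (s, p)) c b
      + RInt (fun s => weighted U req w (s, p)) b b').
    assert (Ba : by_parts U req w w1 (a, p) = 0)
      by (unfold by_parts; rewrite Za, sqrt_0; ring).
    (* Here [g <= 0], so [sqrt] takes its default value 0. *)
    assert (RZ : RInt (fun s => remainder U req w w1 w2 (s, p)) (a0 - h) a = 0).
    { rewrite (RInt_ext _ (fun _ => 0)).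
      - rewrite RInt_const; apply Rmult_0_r.
      - intros s Hs; unfold remainder.
        assert (G : speed2 U req (s, p) <= 0).
        { apply (Sgn s a x y); auto; try lra.
          - apply Near; revert Hs Ka; unfold c, Rmin, Rmax, Rabs.
            destruct (Rle_dec (a0 - h) a), (Rle_dec (a0 - h) (a0 + h)),
              (Rcase_abs h), (Rcase_abs (a - a0)), Hh; lra.
          - assert (s - a < 0 /\ 0 < h \/ 0 < s - a /\ h < 0) as N; [ | clear - N; nra ].
            revert Hs Ka; unfold Rmin, Rmax, Rabs.
            destruct (Rle_dec (a0 - h) a), (Rcase_abs h), (Rcase_abs (a - a0)), Hh; lra. }
        rewrite (sqrt_neg_0 _ G), Rmult_0_r; apply Rmult_0_l. }
    assert (K0 : Rabs (a0 - h - a0) < d1)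
      by (apply Near; unfold Rmin, Rmax; destruct Rle_dec; lra).
    assert (EH : H a = by_parts U req w w1 (c, p)
      + 4 / 3 * RInt (fun s => remainder U req w w1 w2 (s, p)) (a0 - h) c
      + RInt (fun s => weighted U req w (s, p)) c b
      + RInt (fun s => weighted U req w (s, p)) b b').
    { unfold H; rewrite Ba.
      assert (E := RInt_Chasles _ (a0 - h) a c (IR _ _ K0 Ka1) (IR _ _ Ka1 Hc1)).
      unfold plus in E; simpl in E; rewrite <- E, RZ; ring. }
    rewrite <- EH.
    apply is_RInt_gen_from_endpoint.
    + apply from_endpoint_side.
      assert (Hr : 0 < Rabs h - Rabs (a - a0)) by lra.
      exists (mkposreal _ Hr); intros z Hz Side.
      change (Rabs (z - a) < Rabs h - Rabs (a - a0)) in Hz.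
      assert (Sz : 0 < (z - a) * h).
      { destruct Side as [[_ E]|Side]; [ rewrite <- E in Sb; lra | ].
        destruct (Rmult_pos_cases _ _ Side), (Rmult_pos_cases _ _ Sb); try lra;
          [ apply Rmult_lt_0_compat; lra | ].
        rewrite <- Rmult_opp_opp; apply Rmult_lt_0_compat; lra. }
      assert (J : is_RInt (fun s => weighted U req w (s, p)) z c
        (by_parts U req w w1 (c, p) - by_parts U req w w1 (z, p)
         + 4 / 3 * RInt (fun s => remainder U req w w1 w2 (s, p)) z c)).
      { apply is_RInt_weighted; auto; intros s Hs.
        assert (Q : Rabs (s - a0) < d1 /\ (0 < s - a /\ 0 < h \/ s - a < 0 /\ h < 0)).
        { assert (Sz' : 0 < z - a /\ 0 < h \/ z - a < 0 /\ h < 0) by (destruct Hh; nra).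
          clear Sz; revert Hs Hz Ka Sz' Hh1; clear - Hh.
          unfold c, Rmin, Rmax, Rabs.
          destruct (Rle_dec z (a0 + h)), (Rcase_abs (z - a)), (Rcase_abs (a - a0)),
            (Rcase_abs h), (Rcase_abs (s - a0)), Hh; lra. }
        destruct Q as [Q1 Q2].
        destruct (CK s x y) as [P1 [P2 _]]; try lra.
        split; [ exact P1 | split; [ | exact P2 ] ].
        apply (Sgn s a x y); auto; try lra.
        destruct Q2 as [Q2|Q2]; [ now apply Rmult_lt_0_compat | ].
        rewrite <- Rmult_opp_opp; apply Rmult_lt_0_compat; lra. }
      exact (is_RInt_Chasles _ _ _ _ _ _
        (is_RInt_Chasles _ _ _ _ _ _ J (RInt_correct _ _ _ I1)) (RInt_correct _ _ _ I3)).
    + unfold H.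
      apply (continuous_plus (fun z => _ + _) (fun _ => RInt _ b b'));
        [ | apply continuous_const ].
      apply (continuous_plus (fun z => _ + _) (fun _ => RInt _ c b));
        [ | apply continuous_const ].
      apply (continuous_plus (fun z => _ - _) (fun z => _ * _)).
      * apply (continuous_minus (fun _ => by_parts U req w w1 (c, p)));
          [ apply continuous_const | ].
        apply (continuous_section (by_parts U req w w1)).
        destruct (CK a x y) as [P1 [P2 _]]; try lra.
        apply (by_parts_continuous U req w w1 w2); auto.
      * apply (continuous_mult (fun _ => 4 / 3)); [ apply continuous_const | ].
        apply (ex_derive_continuous (V := R_NormedModule)); eexists.
        apply (is_derive_RInt' (V := R_NormedModule)
          (fun s => remainder U req w w1 w2 (s, p)) _ _ c).
        -- assert (Hr : 0 < d1 - Rabs (a - a0)) by lra.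
           exists (mkposreal _ Hr); intros z Hz.
           change (Rabs (z - a) < d1 - Rabs (a - a0)) in Hz.
           apply (RInt_correct (V := R_CompleteNormedModule)), IR; [ | exact Hc1 ].
           replace (z - a0) with ((z - a) + (a - a0)) by ring.
           eapply Rle_lt_trans; [ apply Rabs_triang | lra ].
        -- apply (continuous_section (remainder U req w w1 w2)).
           eapply locally_singleton, C1_params_continuous, CK; lra.
Qed.

(** If [g] vanishes at [r0 L E], this is a turning point, so the choice cannot be one of inertial
    points, as both at once are excluded; then [g] vanishes at [r0] throughout [W], with [g']
    nonzero at [r0 L E]. Otherwise [g] is positive at [r0 L E] as a nonzero limit of positive
    values, and the integral is proper. *)
Lemma trajectory_expansion U req W r0 w w1 w2 r L E :
  smooth_on_positive U -> differentiable_choice U req W r0 -> is_weight w w1 w2 ->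
  0 < r -> W L E -> 0 < speed2 U req (r, (L, E)) -> on_trajectory U req L E r (r0 L E) ->
  exists A, integral_expansion (weighted U req w) r0 A r L E.
Proof.
  intros HU [Hch Hkind] Hw Hr HW Hv [Hpos Hne].
  destruct (Hch L E HW) as [HWl [Ha Hdiff]].
  assert (T1 : turning_point U req L E (r0 L E) <-> speed2 U req (r0 L E, (L, E)) = 0).
  { unfold turning_point, speed2, radial_speed2; simpl.
    set (a := r0 L E); set (u := U a).
    assert (H : 2 * (E + U req - u) - L * (L * 1) / (a * (a * 1))
      = 2 * (E - (/ 2 * (L * (L * 1)) / (a * (a * 1)) + u - U req)))
      by (field; unfold a; lra).
    rewrite H; split; intros; lra. }
  assert (T2 : speed2_1 U (r0 L E, (L, E)) = 0 -> inertial_point U L (r0 L E)).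
  { unfold inertial_point, speed2_1; simpl; intros H.
    set (a := r0 L E) in *.
    replace (a * (a * (a * 1)) * Derive U a) with
      (L * (L * 1) - / 2 * (a * a * a)
         * (-2 * Derive U a + 2 * (L * (L * 1)) / (a * (a * (a * 1)))))
      by (field; lra).
    rewrite H; ring. }
  destruct (Req_dec (speed2 U req (r0 L E, (L, E))) 0) as [Hz|Hnz].
  - destruct Hkind as [Hturn|Hin]; [ | destruct Hne; split; [ now apply T1 | auto ] ].
    apply (integral_from_zero U req w w1 w2); auto.
    + now apply differentiable_continuity_pt.
    + destruct HWl as [d Hd]; exists d; intros x y Hx Hy.
      assert (Hxy := Hd x y Hx Hy).
      assert (Ht := Hturn x y Hxy).
      destruct (Hch x y Hxy) as [_ [Hp _]].
      unfold turning_point in Ht; unfold speed2, radial_speed2; simpl.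
      set (a := r0 x y) in *; clearbody a; rewrite <- Ht; field; lra.
  - apply integral_from_regular_point; [ exact Hdiff | ].
    set (a := r0 L E) in *.
    intros s Hs.
    assert (Hs0 : 0 < s) by (revert Hs; unfold Rmin; destruct Rle_dec; lra).
    apply C1_params_weighted with w1 w2; auto.
    destruct (Req_dec s r) as [->|Hsr]; [ exact Hv | ].
    destruct (Req_dec s a) as [->|Hsa].
    + destruct (Rtotal_order (speed2 U req (a, (L, E))) 0) as [Hlt|[Heq|Hgt]];
        [ exfalso | contradiction | exact Hgt ].
      (* By continuity the squared speed would be negative next to [a]. *)
      assert (C : continuous (fun x => speed2 U req (x, (L, E))) a).
      { apply (continuous_section (speed2 U req)).
        eapply locally_singleton, C1_params_continuous, C1_params_speed2; auto. }
      destruct (C _ (open_lt 0 _ Hlt)) as [d Hd].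
      assert (Hra : r - a <> 0) by lra.
      assert (K := Rmin_pos _ _ (cond_pos d) (Rabs_pos_lt _ Hra)).
      assert (K1 := Rmin_l d (Rabs (r - a))); assert (K2 := Rmin_r d (Rabs (r - a))).
      set (e := Rmin d (Rabs (r - a))) in *.
      set (z := a + if Rlt_dec a r then e / 2 else - (e / 2)).
      assert (N : speed2 U req (z, (L, E)) < 0).
      { apply Hd; change (Rabs (z - a) < d); unfold z.
        clearbody e; destruct (Rlt_dec a r); unfold Rabs; destruct Rcase_abs; lra. }
      assert (P : 0 < speed2 U req (z, (L, E))).
      { apply (Hpos z); unfold z; revert K2; clearbody e; clear z N.
        unfold Rmin, Rmax, Rabs.
        destruct (Rdichotomy _ _ Hra), (Rlt_dec a r), (Rle_dec a r), (Rcase_abs (r - a)); lra. }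
      lra.
    + apply (Hpos s); revert Hs; unfold Rmin, Rmax.
      destruct (Rdichotomy _ _ Hsr), (Rdichotomy _ _ Hsa), (Rle_dec a r); lra.
Qed.

Lemma is_RInt_gen_from_endpoint_ext (f g : R -> R) (a b l : R) :
  0 < a -> 0 < b -> (forall s, 0 < s -> f s = g s) ->
  is_RInt_gen f (from_endpoint a b) (at_point b) l ->
  is_RInt_gen g (from_endpoint a b) (at_point b) l.
Proof.
  intros Ha Hb H; apply is_RInt_gen_ext.
  apply (Filter_prod _ _ _ (fun x => 0 < x) (fun y => y = b)).
  - apply from_endpoint_side; generalize (locally_positive a Ha).
    apply filter_imp; auto.
  - reflexivity.
  - intros x y Hx -> s; simpl; intros Hs; apply H.
    revert Hs; unfold Rmin; destruct Rle_dec; lra.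
Qed.

(** * Noether's theorem *)

(** The equations of motion make both variational derivatives vanish. *)
Lemma noether_first_integral U D I X :
  smooth_on_positive U -> noether_identity U D I X -> first_integral U D I.
Proof.
  intros HU H r th t [Hc Hs] Hj.
  destruct (locally_singleton _ _ Hs) as [Hr [E1 E2]].
  destruct Hc as [Hcr Hcth].
  destruct (locally_singleton _ _ Hcr) as [D1 _].
  destruct (locally_singleton _ _ Hcth) as [_ D2].
  specialize (H r th t (conj Hcr Hcth) Hj).
  rewrite var_r_lagrangian, var_th_lagrangian, E1, E2 in H;
    [ | exact D1 | exact D2 | exact (HU 1%nat _ Hr) ].
  evar_last; [ exact H | field; lra ].
Qed.

(** Realizes an arbitrary position, velocity and acceleration at time [t]. *)
Definition parabola (t c0 c1 c2 s : R) : R := c0 + c1 * (s - t) + c2 / 2 * (s - t) ^ 2.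

Lemma Derive_parabola t c0 c1 c2 s :
  Derive (parabola t c0 c1 c2) s = c1 + c2 * (s - t).
Proof.
  apply is_derive_unique; unfold parabola; auto_derive; [ exact I | field ].
Qed.

Lemma Derive_Derive_parabola t c0 c1 c2 s :
  Derive (Derive (parabola t c0 c1 c2)) s = c2.
Proof.
  rewrite (Derive_ext _ _ _ (Derive_parabola t c0 c1 c2)).
  apply is_derive_unique; auto_derive; [ exact I | ring ].
Qed.

Lemma twice_differentiable_parabola t c0 c1 c2 :
  twice_differentiable_near (parabola t c0 c1 c2) t.
Proof.
  apply (filter_forall (F := locally t)); intros s; split.
  - unfold parabola; auto_derive; exact I.
  - apply ex_derive_ext with (fun s => c1 + c2 * (s - t)).
    + intros u; now rewrite Derive_parabola.
    + auto_derive; exact I.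
Qed.

(* Curves through a given jet with accelerations 0 and 1 separate the two
   components of the characteristic form. *)
Lemma noether_identity_unique U D I X Y :
  smooth_on_positive U ->
  (forall t r th v w, D t r th v w -> 0 < r) ->
  noether_identity U D I X -> noether_identity U D I Y -> equivalent_on D Y X.
Proof.
  intros HU HD HX HY t r th v w HJ.
  assert (Hr := HD _ _ _ _ _ HJ).
  assert (K : forall a b,
    char_r Y t r th v w * (w ^ 2 * r - Derive U r - a)
    + char_th Y t r th v w * (- 2 * w * v * r - r ^ 2 * b)
    = char_r X t r th v w * (w ^ 2 * r - Derive U r - a)
    + char_th X t r th v w * (- 2 * w * v * r - r ^ 2 * b)).
  { intros a b.
    set (x := parabola t r v a); set (y := parabola t th w b).
    assert (Ex : x t = r) by (unfold x, parabola; field).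
    assert (Ey : y t = th) by (unfold y, parabola; field).
    assert (Ex' : Derive x t = v) by (unfold x; rewrite Derive_parabola; ring).
    assert (Ey' : Derive y t = w) by (unfold y; rewrite Derive_parabola; ring).
    assert (Ex'' : Derive (Derive x) t = a) by apply Derive_Derive_parabola.
    assert (Ey'' : Derive (Derive y) t = b) by apply Derive_Derive_parabola.
    assert (C : is_curve x y t) by (split; apply twice_differentiable_parabola).
    assert (J : jet_in D x y t) by (unfold jet_in; now rewrite Ex, Ey, Ex', Ey').
    assert (E := eq_trans (eq_sym (is_derive_unique _ _ _ (HY x y t C J)))
                   (is_derive_unique _ _ _ (HX x y t C J))).
    destruct C as [C1 C2].
    destruct (locally_singleton _ _ C1) as [D1 _].
    destruct (locally_singleton _ _ C2) as [_ D2].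
    rewrite var_r_lagrangian, var_th_lagrangian in E;
      [ | exact D1 | exact D2 | rewrite Ex; exact (HU 1%nat _ Hr) ].
    unfold along in E; now rewrite Ex, Ey, Ex', Ey', Ex'', Ey'' in E. }
  assert (K00 := K 0 0); assert (K10 := K 1 0); assert (K01 := K 0 1); clear K.
  split; [ lra | ].
  apply (Rmult_eq_reg_r (r ^ 2)); [ lra | apply Rgt_not_eq; nra ].
Qed.

Lemma noether_corresponds_intro U D I X :
  smooth_on_positive U ->
  (forall t r th v w, D t r th v w -> 0 < r) ->
  noether_identity U D I X -> noether_corresponds U D I X.
Proof.
  intros HU HD H; split; [ | split; [ exact H | ] ].
  - now apply noether_first_integral with X.
  - intros Y HY; now apply noether_identity_unique with U I.
Qed.

(** * Conserved quantities along arbitrary curves *)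

Lemma is_derive_ang_mom_along r th t :
  is_curve r th t ->
  is_derive (along ang_mom r th) t
    (Derive (Derive th) t * r t ^ 2 + 2 * r t * Derive r t * Derive th t).
Proof.
  intros [C1 C2].
  destruct (locally_singleton _ _ C1) as [D1 _].
  destruct (locally_singleton _ _ C2) as [_ D2].
  unfold along, ang_mom; auto_derive; [ now repeat split | ].
  change (fun x => Derive th x) with (Derive th); change (fun x => r x) with r; ring.
Qed.

Lemma is_derive_energy_along U req r th t :
  is_curve r th t -> 0 < r t -> ex_derive U (r t) ->
  is_derive (along (energy U req) r th) t
    (Derive r t * Derive (Derive r) t + r t * Derive r t * Derive th t ^ 2
     + r t ^ 2 * Derive th t * Derive (Derive th) t + Derive U (r t) * Derive r t).
Proof.
  intros [C1 C2] Hr HU.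
  destruct (locally_singleton _ _ C1) as [D1 D1'].
  destruct (locally_singleton _ _ C2) as [_ D2].
  unfold along, energy, ang_mom; auto_derive.
  - repeat split; auto; apply Rgt_not_eq; nra.
  - change (fun x => Derive th x) with (Derive th); change (fun x => r x) with r.
    change (fun x => Derive r x) with (Derive r); change (fun x => U x) with U.
    field; lra.
Qed.

Lemma noether_identity_ang_mom U :
  smooth_on_positive U -> noether_identity U positive_radius ang_mom X_L.
Proof.
  intros HU r th t C Hr.
  evar_last; [ now apply is_derive_ang_mom_along | ].
  destruct C as [C1 C2].
  destruct (locally_singleton _ _ C1) as [D1 _].
  destruct (locally_singleton _ _ C2) as [_ D2].
  rewrite var_r_lagrangian, var_th_lagrangian;
    [ | exact D1 | exact D2 | exact (HU 1%nat _ Hr) ].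
  unfold along, char_r, char_th; simpl; ring.
Qed.

Lemma noether_identity_energy U req :
  smooth_on_positive U -> noether_identity U positive_radius (energy U req) X_E.
Proof.
  intros HU r th t C Hr.
  evar_last; [ apply is_derive_energy_along; [ exact C | exact Hr | exact (HU 1%nat _ Hr) ] | ].
  destruct C as [C1 C2].
  destruct (locally_singleton _ _ C1) as [D1 _].
  destruct (locally_singleton _ _ C2) as [_ D2].
  rewrite var_r_lagrangian, var_th_lagrangian;
    [ | exact D1 | exact D2 | exact (HU 1%nat _ Hr) ].
  unfold along, char_r, char_th; simpl; ring.
Qed.

(** The definition of the energy solved for [v ^ 2]. With [v <> 0] it makes [g] positive at the
    upper endpoint [r]. *)
Lemma speed2_jets U req t r th v w :
  0 < r ->
  speed2 U req (r, (ang_mom t r th v w, energy U req t r th v w)) = v ^ 2.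
Proof.
  intros Hr; unfold speed2, radial_speed2, energy, ang_mom; simpl; field; lra.
Qed.

Lemma sign_mult_Rabs v : sign v * v = Rabs v.
Proof.
  destruct (Rtotal_order v 0) as [H|[->|H]].
  - rewrite sign_eq_m1, Rabs_left; lra.
  - rewrite Rabs_R0; ring.
  - rewrite sign_eq_1, Rabs_pos_eq; lra.
Qed.

Lemma locally_sign v : v <> 0 -> locally v (fun u => sign u = sign v).
Proof.
  intros H; destruct (Rdichotomy _ _ H) as [Hv|Hv].
  - generalize (open_lt 0 v Hv); apply filter_imp; intros u Hu.
    now rewrite !sign_eq_m1.
  - generalize (open_gt 0 v Hv); apply filter_imp; intros u Hu.
    now rewrite !sign_eq_1.
Qed.

Lemma filterlim_pair_fst (f g : R -> R) (t y : R) :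
  continuous f t -> continuous g t ->
  filterlim (fun z : R * R => (f (fst z), g (fst z))) (locally (t, y)) (locally (f t, g t)).
Proof.
  intros Hf Hg P [d Hd].
  destruct (Hf _ (locally_ball (f t) d)) as [d1 H1].
  destruct (Hg _ (locally_ball (g t) d)) as [d2 H2].
  exists (mkposreal _ (Rmin_pos _ _ (cond_pos d1) (cond_pos d2))).
  intros [u v] [Hu _]; apply Hd; split;
    [ apply H1 | apply H2 ]; apply (ball_le _ _ _ (Rmin_l d1 d2))
      || apply (ball_le _ _ _ (Rmin_r d1 d2)); exact Hu.
Qed.

Lemma continuous_near (f : R -> R) (t : R) (d : posreal) :
  continuous f t -> locally t (fun s => Rabs (f s - f t) < d).
Proof. intros H; exact (H _ (locally_ball (f t) d)). Qed.

(** Common form of the two cases: [ct = 0], [cth = 1], [m L = L] for [Theta], and [ct = 1],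
    [cth = 0], [m L = 1] for [T]. The last hypothesis on [m] and [w] is the cancellation of the
    explicit motion in [(t, theta)] against that of the endpoint [r]. Convergence and
    differentiability are also concluded, so that neither [integral] nor [Derive] stands for a
    default value. *)
Lemma dynamical_symmetry U req W r0
    (F : R -> R -> R -> R -> R -> R -> R) (J : R -> R -> R -> R -> R)
    (w w1 w2 : R -> R -> R) (m m' : R -> R) (ct cth : R) :
  smooth_on_positive U -> differentiable_choice U req W r0 ->
  (forall sg, is_weight (w sg) (w1 sg) (w2 sg)) ->
  (forall sg L E s, 0 < s -> weighted U req (w sg) (s, (L, E)) = J sg L E s) ->
  (forall L, is_derive m L (m' L)) ->
  (forall sg t r th L E,
     F sg t r th L E = ct * t + cth * th - m L * integral (J sg L E) (r0 L E) r) ->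
  (forall r v om, 0 < r -> v <> 0 ->
     ct + cth * om = m (om * r ^ 2) * (w (sign v) r / Rabs v * v)) ->
  (forall t r th v om,
     trajectory_domain U req W r0 t r th v om ->
     let L := ang_mom t r th v om in
     let E := energy U req t r th v om in
     integral_converges (J (sign v) L E) (r0 L E) r /\
     differentiable_pt (F (sign v) t r th) L E) /\
  noether_corresponds U (trajectory_domain U req W r0)
    (on_jets U req F) (X_dynamical U req F).
Proof.
  intros HU Hr0 Hw HJ Hm HF Hflow.
  assert (Main : forall t r th v om, trajectory_domain U req W r0 t r th v om ->
    let L := ang_mom t r th v om in
    let E := energy U req t r th v om in
    exists A : R -> R -> R, differentiable_pt A L E /\
    exists d : posreal, forall r' l e,
      Rabs (r' - r) < d -> Rabs (l - L) < d -> Rabs (e - E) < d ->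
      is_RInt_gen (J (sign v) l e) (from_endpoint (r0 l e) r') (at_point r')
        (A l e + RInt (fun s => weighted U req (w (sign v)) (s, (l, e))) r r')).
  { intros t r th v om [Hr [Hv [HW Htr]]] L E; fold L E in HW, Htr.
    assert (Hs : 0 < speed2 U req (r, (L, E))).
    { unfold L, E; rewrite speed2_jets by exact Hr.
      rewrite <- (pow2_abs v); apply pow_lt, Rabs_pos_lt, Hv. }
    destruct (trajectory_expansion U req W r0 (w (sign v)) _ _ r L E HU Hr0
                (Hw (sign v)) Hr HW Hs Htr) as [A [HA [d Hd]]].
    exists A; split; [ exact HA | ].
    destruct (proj1 Hr0 L E HW) as [[d' Hd'] _].
    (* The radius [d'] keeps [(l, e)] in [W], where [r0] is positive, and the radius [r] keeps [r']
       positive; [J] and [weighted] agree only at positive radii. *)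
    exists (mkposreal _ (Rmin_pos _ _ (cond_pos d) (Rmin_pos _ _ (cond_pos d')
              Hr))); simpl.
    assert (M1 := Rmin_l d (Rmin d' r)).
    assert (M2 := Rle_trans _ _ _ (Rmin_r d (Rmin d' r)) (Rmin_l d' r)).
    assert (M3 := Rle_trans _ _ _ (Rmin_r d (Rmin d' r)) (Rmin_r d' r)).
    set (n := Rmin d (Rmin d' r)) in *; clearbody n.
    intros r' l e Kr Kl Ke.
    apply (is_RInt_gen_from_endpoint_ext
             (fun s => weighted U req (w (sign v)) (s, (l, e)))).
    - apply (proj1 Hr0 l e), Hd'; lra.
    - revert Kr; unfold Rabs; destruct Rcase_abs; lra.
    - intros s; apply HJ.
    - apply Hd; lra. }
  assert (Diff : forall t r th v om,
     trajectory_domain U req W r0 t r th v om ->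
     let L := ang_mom t r th v om in
     let E := energy U req t r th v om in
     integral_converges (J (sign v) L E) (r0 L E) r /\
     differentiable_pt (F (sign v) t r th) L E).
  { intros t r th v om HD L E.
    destruct (Main t r th v om HD) as [A [HA [d Hd]]]; fold L E in HA, Hd.
    assert (R0 : forall z : R, Rabs (z - z) < d)
      by (intros z; rewrite Rminus_diag, Rabs_R0; apply cond_pos).
    split; [ eexists; apply Hd; apply R0 | ].
    apply differentiable_pt_ext_loc
      with (fun l e => (ct * t + cth * th) + -1 * (m l * A l e)).
    - exists d; intros l e Hl He; rewrite HF; unfold integral.
      rewrite (is_RInt_gen_unique _ _ (Hd r l e (R0 r) Hl He)), RInt_point.
      change zero with 0; ring.
    - apply differentiable_pt_plus; [ apply differentiable_pt_const | ].
      apply differentiable_pt_scal, differentiable_pt_mult; [ | exact HA ].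
      exists (m' L), 0; apply differentiable_pt_lim_proj1_0, is_derive_Reals, Hm. }
  split; [ exact Diff | ].
  apply noether_corresponds_intro; [ exact HU | intros t r th v om HD; apply HD | ].
  intros r th t C HD.
  destruct (Main _ _ _ _ _ HD) as [A [_ [d Hd]]].
  destruct (Diff _ _ _ _ _ HD) as [_ [FL [FE HFd]]].
  destruct (differentiable_pt_lim_unique _ _ _ _ _ HFd) as [EL EE].
  clear Main Diff; destruct HD as [Hr [Hv [HW Htr]]].
  set (v := Derive r t) in *; set (om := Derive th t) in *.
  set (sg := sign v) in *.
  set (l := along ang_mom r th); set (e := along (energy U req) r th).
  change (ang_mom t (r t) (th t) v om) with (l t) in *.
  change (energy U req t (r t) (th t) v om) with (e t) in *.
  assert (HUr := HU 1%nat _ Hr : ex_derive U (r t)).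
  assert (Dl := is_derive_ang_mom_along r th t C : is_derive l t _).
  assert (De := is_derive_energy_along U req r th t C Hr HUr : is_derive e t _).
  destruct C as [C1 C2].
  destruct (locally_singleton _ _ C1) as [D1 D1'].
  destruct (locally_singleton _ _ C2) as [D2 D2'].
  assert (Dr := Derive_correct _ _ D1); assert (Dth := Derive_correct _ _ D2).
  fold v in Dr, Dl, De; fold om in Dth, Dl, De.
  assert (Cl : continuous l t)
    by (apply (ex_derive_continuous (V := R_NormedModule)); eexists; exact Dl).
  assert (Ce : continuous e t)
    by (apply (ex_derive_continuous (V := R_NormedModule)); eexists; exact De).
  assert (Cr : continuous r t)
    by (apply (ex_derive_continuous (V := R_NormedModule)); exact D1).
  assert (Cv : continuous (Derive r) t)
    by (apply (ex_derive_continuous (V := R_NormedModule)); exact D1').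
  assert (Hs2 : speed2 U req (r t, (l t, e t)) = v ^ 2) by (now apply speed2_jets).
  assert (Hs : 0 < speed2 U req (r t, (l t, e t)))
    by (rewrite Hs2, <- pow2_abs; apply pow_lt, Rabs_pos_lt, Hv).
  set (K := fun s => RInt (fun x => weighted U req (w sg) (x, (l s, e s))) (r t) (r s)).
  assert (DK : derivable_pt_lim K t (weighted U req (w sg) (r t, (l t, e t)) * v)).
  (* Time is the first parameter of the two-parameter lemma; the second is a dummy, taken at 0. *)
  { apply (differentiable_pt_lim_proj1_1 _ _ 0).
    rewrite <- (Rmult_0_r (weighted U req (w sg) (r t, (l t, e t)))) at 2.
    apply (differentiable_RInt_endpoint (weighted U req (w sg))
             (fun s _ => r s) (fun s _ => (l s, e s)) t 0).
    - apply C1_params_continuous.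
      apply (C1_params_weighted U req (w sg) (w1 sg) (w2 sg)); auto.
    - now apply differentiable_pt_lim_proj1_0, is_derive_Reals.
    - now apply filterlim_pair_fst. }
  apply is_derive_Reals in DK.
  assert (DF := derivable_pt_lim_comp_2d (F sg t (r t) (th t)) l e t FL FE _ _ HFd
    (proj1 (is_derive_Reals _ _ _) Dl) (proj1 (is_derive_Reals _ _ _) De)).
  apply is_derive_Reals in DF.
  assert (Dm := is_derive_comp m l t _ _ (Hm (l t)) Dl).
  (* [F] is split into its variation in [(L, E)] at frozen [(t, r, theta)], its explicit part in
     time and angle, and the short integral [K]. The last two cancel to first order, and the
     derivative of [m] is multiplied by [K t = 0]. *)
  apply is_derive_ext_loc with (fun s =>
    F sg t (r t) (th t) (l s) (e s) + (ct * (s - t) + cth * (th s - th t))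
    - m (l s) * K s).
  (* As [v] is nonzero its sign is constant near [t], in agreement with [sg] being held fixed in the
     derivatives. *)
  { assert (Sg : locally t (fun s => sign (Derive r s) = sg))
      by exact (Cv _ (locally_sign v Hv)).
    generalize (filter_and _ _ Sg (filter_and _ _ (continuous_near r t d Cr)
      (filter_and _ _ (continuous_near l t d Cl) (continuous_near e t d Ce)))).
    apply filter_imp; intros s [Ss [Kr [Kl Ke]]].
    unfold along at 1, on_jets; rewrite Ss.
    change (ang_mom s (r s) (th s) (Derive r s) (Derive th s)) with (l s).
    change (energy U req s (r s) (th s) (Derive r s) (Derive th s)) with (e s).
    rewrite !HF; unfold integral.
    rewrite (is_RInt_gen_unique _ _ (Hd (r s) (l s) (e s) Kr Kl Ke)).
    assert (R0 : Rabs (r t - r t) < d)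
      by (rewrite Rminus_diag, Rabs_R0; apply cond_pos).
    rewrite (is_RInt_gen_unique _ _ (Hd (r t) (l s) (e s) R0 Kl Ke)), RInt_point.
    fold (K s); change zero with 0; apply Rminus_diag_uniq; ring. }
  assert (K0 : K t = 0) by (unfold K; rewrite RInt_point; reflexivity).
  assert (Dmid : is_derive (fun s => ct * (s - t) + cth * (th s - th t)) t
                   (ct + cth * om)).
  { auto_derive; [ exact D2 | ].
    change (fun x => th x) with th; fold om; ring. }
  evar_last.
  { apply (is_derive_minus (fun s => _ + _) (fun s => m (l s) * K s)).
    - apply (is_derive_plus _ _ _ _ _ DF Dmid).
    - apply (is_derive_mult (fun s => m (l s)) K _ _ _ Dm DK Rmult_comm). }
  rewrite var_r_lagrangian, var_th_lagrangian; [ | exact D1 | exact D2' | exact HUr ].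
  unfold along, char_r, char_th, X_dynamical, on_jets; simpl.
  fold v om sg.
  change (ang_mom t (r t) (th t) v om) with (l t).
  change (energy U req t (r t) (th t) v om) with (e t).
  unfold dL, dE; rewrite EL, EE.
  assert (Hfl := Hflow (r t) v om Hr Hv).
  change (om * r t ^ 2) with (l t) in Hfl.
  assert (Ew : weighted U req (w sg) (r t, (l t, e t)) = w sg (r t) / Rabs v)
    by (unfold weighted; rewrite Hs2, <- pow2_abs, sqrt_pow2; [ reflexivity | apply Rabs_pos ]).
  fold sg in Hfl; rewrite <- Ew in Hfl.
  unfold minus, plus, opp, scal, mult; simpl; unfold mult; simpl.
  rewrite K0, Hfl; ring.
Qed.

Lemma is_weight_const c : is_weight (fun _ => c) (fun _ => 0) (fun _ => 0).
Proof.
  intros s _; split; [ | split; [ | apply continuous_const ] ];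
    apply (is_derive_const (V := R_NormedModule)).
Qed.

Lemma is_weight_inv_sqr c :
  is_weight (fun s => c / s ^ 2) (fun s => - 2 * c / s ^ 3) (fun s => 6 * c / s ^ 4).
Proof.
  intros s Hs.
  assert (N : forall n, s ^ n <> 0) by (intros n; apply pow_nonzero; lra).
  split; [ | split ].
  - auto_derive; [ exact (N 2%nat) | field; lra ].
  - auto_derive; [ exact (N 3%nat) | field; lra ].
  - apply (ex_derive_continuous (V := R_NormedModule)); auto_derive; exact (N 4%nat).
Qed.

Theorem proposition5
  (U : R -> R) (req : R) (W : R -> R -> Prop) (r0 : R -> R -> R)
  (HU : smooth_on_positive U)
  (Hreq : 0 < req /\ Derive U req = 0)
  (Hr0 : differentiable_choice U req W r0) :
  (noether_corresponds U positive_radius ang_mom X_L /\ is_point X_L) /\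
  (noether_corresponds U positive_radius (energy U req) X_E /\ is_point X_E) /\
  (forall t r th v w,
     trajectory_domain U req W r0 t r th v w ->
     let L := ang_mom t r th v w in
     let E := energy U req t r th v w in
     integral_converges (Theta_integrand U req (sign v) L E) (r0 L E) r /\
     integral_converges (T_integrand U req (sign v) L E) (r0 L E) r /\
     differentiable_pt (Theta U req r0 (sign v) t r th) L E /\
     differentiable_pt (T U req r0 (sign v) t r th) L E) /\
  noether_corresponds U (trajectory_domain U req W r0)
    (on_jets U req (Theta U req r0)) (X_dynamical U req (Theta U req r0)) /\
  noether_corresponds U (trajectory_domain U req W r0)
    (on_jets U req (T U req r0)) (X_dynamical U req (T U req r0)).
Proof.
  destruct (dynamical_symmetry U req W r0 (Theta U req r0) (Theta_integrand U req)
    (fun sg s => sg / s ^ 2) (fun sg s => - 2 * sg / s ^ 3) (fun sg s => 6 * sg / s ^ 4)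
    (fun L => L) (fun _ => 1) 0 1) as [A1 B1]; auto.
  { apply is_weight_inv_sqr. }
  { intros sg L E s Hs; unfold weighted, Theta_integrand, speed2, radial_speed2.
    cbn [fst snd].
    (* Taking [s ^ 4] out of the root leaves the squared radial speed and the weight
       [sg / s ^ 2]. *)
    set (g := 2 * (E + U req - U s) - L ^ 2 / s ^ 2).
    replace (2 * (E + U req - U s) * s ^ 4 - L ^ 2 * s ^ 2) with ((s ^ 2) ^ 2 * g)
      by (unfold g; field; lra).
    rewrite sqrt_mult_alt, sqrt_pow2 by apply pow2_ge_0.
    unfold Rdiv; rewrite Rinv_mult; ring. }
  { intros L; apply (is_derive_id (K := R_AbsRing)). }
  { intros; unfold Theta; ring. }
  { intros r v om Hr Hv; rewrite <- sign_mult_Rabs; field.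
    repeat split; first [ exact Hv | lra | now apply sign_neq_0 ]. }
  destruct (dynamical_symmetry U req W r0 (T U req r0) (T_integrand U req)
    (fun sg _ => sg) (fun _ _ => 0) (fun _ _ => 0)
    (fun _ => 1) (fun _ => 0) 1 0) as [A2 B2]; auto.
  { apply is_weight_const. }
  { intros L; apply (is_derive_const (V := R_NormedModule)). }
  { intros; unfold T; ring. }
  { intros r v om Hr Hv; rewrite <- sign_mult_Rabs; field.
    split; first [ exact Hv | now apply sign_neq_0 ]. }
  split; [ | split; [ | split; [ | split; [ exact B1 | exact B2 ] ] ] ].
  - split; [ | repeat split ].
    apply noether_corresponds_intro; auto; now apply noether_identity_ang_mom.
  - split; [ | repeat split ].
    apply noether_corresponds_intro; auto; now apply noether_identity_energy.
  - intros t r th v w HD L E.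
    destruct (A1 t r th v w HD) as [C1 D1], (A2 t r th v w HD) as [C2 D2].
    repeat split; assumption.
Qed.
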